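(* The $\mathbb F$-algebra homomorphism $\zeta\colon \Re\to \mathfrak{BI}$ is injective.
   Context: $\mathbb F$ is a field with $\operatorname{char}\mathbb F\neq 2$. Algebras are associative with unit $1$, and homomorphisms preserve $1$. $[a,b]=ab-ba$ and $\{a,b\}=ab+ba$. The Racah algebra $\Re$ is the $\mathbb F$-algebra defined by generators $A,B,C,D$ and the relations asserting that $[A,B]=[B,C]=[C,A]=2D$ and that each of $[A,D]+AC-BA$, $[B,D]+BA-CB$, $[C,D]+CB-AC$ is central in $\Re$. It is generated as an algebra by $A,B,C$. The Bannai--Ito algebra $\mathfrak{BI}$ is the $\mathbb F$-algebra defined by generators $X,Y,Z$ and the relations asserting that each of $\{X,Y\}-Z$, $\{Y,Z\}-X$, $\{Z,X\}-Y$ is central in $\mathfrak{BI}$. $\zeta\colon\Re\to\mathfrak{BI}$ is the unique $\mathbb F$-algebra homomorphism (known to exist) that sends $$A\mapsto \frac{(2X-3)(2X+1)}{16},\qquad B\mapsto \frac{(2Y-3)(2Y+1)}{16},\qquad C\mapsto\frac{(2Z-3)(2Z+1)}{16}.$$ *)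

(* Defs.v *)
From HB Require Import structures.
From mathcomp Require Import all_boot all_order all_algebra.
From mathcomp Require Import boolp ring.
From Stdlib Require Ncring_tac.
From mathcomp.multinomials Require Import monalg.

Set Implicit Arguments.
Unset Strict Implicit.
Unset Printing Implicit Defensive.

Import GRing.Theory.
Local Open Scope ring_scope.
Local Open Scope quotient_scope.

Definition commutator (R : pzRingType) (a b : R) : R := a * b - b * a.
Definition anticommutator (R : pzRingType) (a b : R) : R := a * b + b * a.

Lemma rmorph_commutator (R S : pzRingType) (f : {rmorphism R -> S}) x y :
  f (commutator x y) = commutator (f x) (f y).
Proof. by rewrite rmorphB !rmorphM. Qed.

Lemma rmorph_anticommutator (R S : pzRingType) (f : {rmorphism R -> S}) x y :
  f (anticommutator x y) = anticommutator (f x) (f y).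
Proof. by rewrite rmorphD !rmorphM. Qed.

Lemma rmorph_racah_relation (R S : pzRingType) (f : {rmorphism R -> S})
    x y t v :
  f (commutator x y + x * t - v * x)
  = commutator (f x) (f y) + f x * f t - f v * f x.
Proof. by rewrite rmorphB rmorphD rmorph_commutator !rmorphM. Qed.

Section TwoSidedIdeal.
Variables (R : nzRingType) (S : R -> Prop).

Inductive ideal_gen : R -> Prop :=
| ideal_gen_incl r : S r -> ideal_gen r
| ideal_gen0 : ideal_gen 0
| ideal_genB x y : ideal_gen x -> ideal_gen y -> ideal_gen (x - y)
| ideal_genMl a x : ideal_gen x -> ideal_gen (a * x)
| ideal_genMr x a : ideal_gen x -> ideal_gen (x * a).

Definition ideal_pred : {pred R} := fun x => `[< ideal_gen x >].

Lemma ideal_pred_zmod : zmod_closed ideal_pred.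
Proof.
split; first exact/asboolP/ideal_gen0.
by move=> x y /asboolP Ix /asboolP Iy; apply/asboolP/ideal_genB.
Qed.
HB.instance Definition _ :=
  GRing.isZmodClosed.Build R ideal_pred ideal_pred_zmod.

Lemma ideal_predMl a x : x \in ideal_pred -> a * x \in ideal_pred.
Proof. by move=> /asboolP Ix; apply/asboolP/ideal_genMl. Qed.

Lemma ideal_predMr a x : x \in ideal_pred -> x * a \in ideal_pred.
Proof. by move=> /asboolP Ix; apply/asboolP/ideal_genMr. Qed.
End TwoSidedIdeal.

(* Noncommutative polynomials in n variables. *)
Notation free_alg F n := {malg F[{fmonom 'I_n}]}.

Section FreeAlgebra.
Variables (F : fieldType) (n : nat).
Implicit Types x y : free_alg F n.

Definition free_gen (i : 'I_n) : free_alg F n := << fmu i >>.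

Lemma free_scaleE (c : F) x : c *: x = x * malgC c.
Proof.
rewrite malgM_def fgmulgU malgZ_def.
by apply: eq_bigr => k _; rewrite mulm1 mulrC.
Qed.
End FreeAlgebra.

(* An algType is a nontrivial ring, hence the second field. *)
Record presentation (F : fieldType) (n : nat) := Presentation {
  relator :> free_alg F n -> Prop;
  relator_proper : ~ ideal_gen relator 1
}.

Section PresentedAlgebra.
Variables (F : fieldType) (n : nat) (P : presentation F n).
Local Notation A := (free_alg F n).
Local Notation I := (ideal_pred P : zmodClosed A).

Definition presented_alg : Type := Quotient.quot I.
HB.instance Definition _ := GRing.Zmodule.on presented_alg.
HB.instance Definition _ := ZmodQuotient.on presented_alg.

Local Notation Q := presented_alg.

Lemma pres_piE (x y : A) : (x == y %[mod Q]) = (x - y \in I).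
Proof. exact/esym/Quotient.idealrBE. Qed.

Lemma pres_sub_repr (x : A) : x - repr (\pi_Q x) \in ideal_pred P.
Proof. by have := pres_piE x (repr (\pi_Q x)); rewrite reprK eqxx => <-. Qed.

Definition pres_one : Q := lift_cst Q 1.
Definition pres_mul : Q -> Q -> Q := lift_op2 Q *%R.
Definition pres_scale (c : F) : Q -> Q := lift_op1 Q ( *:%R c).

Canonical pres_one_morph := PiConst pres_one.

Lemma pi_pres_mul : {morph \pi_Q : x y / x * y >-> pres_mul x y}.
Proof.
move=> x y; unlock pres_mul; apply/eqP; rewrite pres_piE.
set x' := repr _; set y' := repr _.
have -> : x * y - x' * y' = x * (y - y') + (x - x') * y'.
  by rewrite mulrBr mulrBl addrA subrK.
by apply: rpredD; [apply: ideal_predMl | apply: ideal_predMr];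
  exact: pres_sub_repr.
Qed.
Canonical pres_mul_morph := PiMorph2 pi_pres_mul.

Lemma pi_pres_scale c : {morph \pi_Q : x / c *: x >-> pres_scale c x}.
Proof.
move=> x; unlock pres_scale; apply/eqP; rewrite pres_piE -scalerBr.
by rewrite free_scaleE; apply: ideal_predMr; apply: pres_sub_repr.
Qed.
Canonical pres_scale_morph c := PiMorph1 (pi_pres_scale c).

Lemma pres_mulA : associative pres_mul.
Proof. by move=> x y z; rewrite -[x]reprK -[y]reprK -[z]reprK !piE mulrA. Qed.

Lemma pres_mul1 : left_id pres_one pres_mul.
Proof. by move=> x; rewrite -[x]reprK !piE mul1r. Qed.

Lemma pres_mulr1 : right_id pres_one pres_mul.
Proof. by move=> x; rewrite -[x]reprK !piE mulr1. Qed.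

Lemma pres_mulDl : left_distributive pres_mul +%R.
Proof. by move=> x y z; rewrite -[x]reprK -[y]reprK -[z]reprK !piE mulrDl. Qed.

Lemma pres_mulDr : right_distributive pres_mul +%R.
Proof. by move=> x y z; rewrite -[x]reprK -[y]reprK -[z]reprK !piE mulrDr. Qed.

Lemma pres_one_neq0 : pres_one != 0.
Proof.
rewrite piE Quotient.equivE subr0.
by apply/asboolP; apply: relator_proper.
Qed.

HB.instance Definition _ := GRing.Zmodule_isNzRing.Build Q
  pres_mulA pres_mul1 pres_mulr1 pres_mulDl pres_mulDr pres_one_neq0.

Lemma pres_scaleA a b v : pres_scale a (pres_scale b v) = pres_scale (a * b) v.
Proof. by rewrite -[v]reprK !piE scalerA. Qed.

Lemma pres_scale1 : left_id 1 pres_scale.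
Proof. by move=> v; rewrite -[v]reprK !piE scale1r. Qed.

Lemma pres_scaleDr : right_distributive pres_scale +%R.
Proof. by move=> a u v; rewrite -[u]reprK -[v]reprK !piE scalerDr. Qed.

Lemma pres_scaleDl v : {morph pres_scale^~ v : a b / a + b}.
Proof. by move=> a b; rewrite -[v]reprK !piE scalerDl. Qed.

HB.instance Definition _ := GRing.Zmodule_isLmodule.Build F Q
  pres_scaleA pres_scale1 pres_scaleDr pres_scaleDl.

Lemma pres_scaleAl (c : F) (u v : Q) : c *: (u * v) = (c *: u) * v.
Proof.
rewrite -[u]reprK -[v]reprK.
change (pres_scale c (pres_mul (\pi_Q (repr u)) (\pi_Q (repr v))) =
  pres_mul (pres_scale c (\pi_Q (repr u))) (\pi_Q (repr v))).
by rewrite !piE scalerAl.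
Qed.

HB.instance Definition _ := GRing.Lmodule_isLalgebra.Build F Q pres_scaleAl.

Lemma pres_scaleAr (c : F) (u v : Q) : c *: (u * v) = u * (c *: v).
Proof.
rewrite -[u]reprK -[v]reprK.
change (pres_scale c (pres_mul (\pi_Q (repr u)) (\pi_Q (repr v))) =
  pres_mul (\pi_Q (repr u)) (pres_scale c (\pi_Q (repr v)))).
by rewrite !piE !free_scaleE mulrA.
Qed.

HB.instance Definition _ := GRing.Lalgebra_isAlgebra.Build F Q pres_scaleAr.

Definition pres_pi : A -> Q := \pi_Q.

Lemma pres_pi_is_nmod : nmod_morphism pres_pi.
Proof. by split => [|x y]; rewrite /pres_pi !piE. Qed.
Lemma pres_pi_is_monoid : monoid_morphism pres_pi.
Proof.
by split => [|x y]; [rewrite /pres_pi piE | exact: pi_pres_mul].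
Qed.
Lemma pres_pi_is_scalable : scalable pres_pi.
Proof. by move=> c x; exact: pi_pres_scale. Qed.

HB.instance Definition _ := GRing.isNmodMorphism.Build A Q pres_pi
  pres_pi_is_nmod.
HB.instance Definition _ := GRing.isMonoidMorphism.Build A Q pres_pi
  pres_pi_is_monoid.
HB.instance Definition _ := GRing.isScalable.Build F A Q *:%R pres_pi
  pres_pi_is_scalable.

Definition pres_gen (i : 'I_n) : Q := pres_pi (free_gen F i).

Lemma pres_pi_surj (q : Q) : exists x, q = pres_pi x.
Proof. by exists (repr q); rewrite /pres_pi reprK. Qed.

Lemma pres_pi_eq0 x : pres_pi x = 0 <-> ideal_gen P x.
Proof.
rewrite -(raddf0 pres_pi); split=> [/eqP|Ix].
  by rewrite [_ == _]pres_piE subr0 => /asboolP.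
by apply/eqP; rewrite [_ == _]pres_piE subr0; apply/asboolP.
Qed.
End PresentedAlgebra.

Section UniversalProperty.
Variables (F : fieldType) (n : nat) (S : algType F) (g : 'I_n -> S).
Local Notation A := (free_alg F n).

Definition word_eval (w : {fmonom 'I_n}) : S := \prod_(i <- w) g i.

Lemma word_eval_is_mmorphism : mmorphism word_eval.
Proof.
by split=> [x y|]; rewrite /word_eval ?fmM ?fm1 ?big_cat ?big_nil.
Qed.
HB.instance Definition _ :=
  monalg.isMultiplicative.Build _ S word_eval word_eval_is_mmorphism.

Definition free_eval : A -> S := mmap (in_alg S) word_eval.
HB.instance Definition _ := GRing.Additive.on free_eval.

Lemma free_eval_is_monoid : monoid_morphism free_eval.
Proof.
have [] // := @commr_mmap_is_multiplicative _ F S (in_alg S) word_eval.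
by move=> x m m'; rewrite /GRing.comm /= mulr_algl mulr_algr.
Qed.
HB.instance Definition _ := GRing.isMonoidMorphism.Build A S free_eval
  free_eval_is_monoid.

Lemma free_eval_is_scalable : scalable free_eval.
Proof. by move=> c x; rewrite /free_eval mmapZ /= mulr_algl. Qed.
HB.instance Definition _ := GRing.isScalable.Build F A S *:%R free_eval
  free_eval_is_scalable.

Lemma free_eval_gen i : free_eval (free_gen F i) = g i.
Proof.
by rewrite /free_eval mmapU /= scale1r mul1r /word_eval fmU big_seq1.
Qed.

Lemma ideal_gen_eval0 (P : A -> Prop) :
  (forall r, P r -> free_eval r = 0) ->
  forall x, ideal_gen P x -> free_eval x = 0.
Proof.
move=> P0 x; elim=> [r /P0 //||u v _ u0 _ v0|a u _ u0|u a _ u0].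
- exact: raddf0.
- by rewrite raddfB /= u0 v0 subr0.
- by rewrite rmorphM /= u0 mulr0.
- by rewrite rmorphM /= u0 mul0r.
Qed.

Variable P : presentation F n.

Lemma presented_alg_lift : (forall r, P r -> free_eval r = 0) ->
  exists f : {lrmorphism presented_alg P -> S},
    forall i, f (pres_gen P i) = g i.
Proof.
move=> /ideal_gen_eval0 I0.
pose f (q : presented_alg P) := free_eval (repr q).
have fpi x : f (pres_pi P x) = free_eval x.
  apply/esym/eqP; rewrite -subr_eq0 -raddfB; apply/eqP/I0/pres_pi_eq0.
  by rewrite raddfB /= /pres_pi reprK subrr.
have fN : nmod_morphism f.
  split=> [|u v]; first by rewrite -(raddf0 (pres_pi P)) fpi raddf0.
  have [[x ->] [y ->]] := (pres_pi_surj u, pres_pi_surj v).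
  by rewrite -raddfD !fpi raddfD.
have fM : monoid_morphism f.
  split=> [|u v]; first by rewrite -(rmorph1 (pres_pi P)) fpi rmorph1.
  have [[x ->] [y ->]] := (pres_pi_surj u, pres_pi_surj v).
  by rewrite -rmorphM !fpi rmorphM.
have fZ : scalable f.
  by move=> c u; have [x ->] := pres_pi_surj u; rewrite -linearZ !fpi linearZ.
pose aN := GRing.isNmodMorphism.Build _ _ f fN.
pose aM := GRing.isMonoidMorphism.Build _ _ f fM.
pose aZ := GRing.isScalable.Build F (presented_alg P) S *:%R f fZ.
pose fL : {lrmorphism presented_alg P -> S} := HB.pack f aN aM aZ.
by exists fL => i; rewrite /= fpi free_eval_gen.
Qed.

Lemma presented_alg_ext (f1 f2 : {lrmorphism presented_alg P -> S}) :
  (forall i, f1 (pres_gen P i) = f2 (pres_gen P i)) -> f1 =1 f2.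
Proof.
move=> f12 q; have [x ->] := pres_pi_surj q.
rewrite [x]monalgE !raddf_sum; apply: eq_bigr => w _ /=.
have -> : << x@_w *g w >> = x@_w *: << w >> :> A.
  by apply/malgP=> k; rewrite mcoeffZ !mcoeffU mulr_natr.
rewrite !linearZ; congr (_ *: _) => /=; case: w => s.
elim: s => [|i s IHs].
  have -> : << FMonom [::] >> = 1 :> A by rewrite -fmoneE.
  by rewrite !rmorph1.
have -> : << FMonom (i :: s) >> = free_gen F i * << FMonom s >> :> A.
  by rewrite malgM_def fgmulUU mulr1; congr << _ >>; apply/eqP;
     rewrite fmP /= fmM fmU.
by rewrite !rmorphM /= IHs; congr (_ * _); exact: f12.
Qed.
End UniversalProperty.

Section Presentations.
Variable F : fieldType.

(* "w is central" is imposed through the relators [w, u] for all u. *)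
Section Racah.
Notation A := (@free_gen F 4 (inord 0)).
Notation B := (@free_gen F 4 (inord 1)).
Notation C := (@free_gen F 4 (inord 2)).
Notation D := (@free_gen F 4 (inord 3)).

Inductive racah_relator : free_alg F 4 -> Prop :=
| racah_AB : racah_relator (commutator A B - D *+ 2)
| racah_BC : racah_relator (commutator B C - D *+ 2)
| racah_CA : racah_relator (commutator C A - D *+ 2)
| racah_alpha u :
    racah_relator (commutator (commutator A D + A * C - B * A) u)
| racah_beta u :
    racah_relator (commutator (commutator B D + B * A - C * B) u)
| racah_gamma u :
    racah_relator (commutator (commutator C D + C * B - A * C) u).
End Racah.

Section BannaiIto.
Notation X := (@free_gen F 3 (inord 0)).
Notation Y := (@free_gen F 3 (inord 1)).
Notation Z := (@free_gen F 3 (inord 2)).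

Inductive bi_relator : free_alg F 3 -> Prop :=
| bi_kappa u : bi_relator (commutator (anticommutator X Y - Z) u)
| bi_lambda u : bi_relator (commutator (anticommutator Y Z - X) u)
| bi_mu u : bi_relator (commutator (anticommutator Z X - Y) u).
End BannaiIto.

Lemma relator_proper_eval0 n (P : free_alg F n -> Prop) :
  (forall r, P r -> free_eval (fun _ => 0 : F^o) r = 0) -> ~ ideal_gen P 1.
Proof.
by move=> P0 /(ideal_gen_eval0 P0)/eqP; rewrite rmorph1 oner_eq0.
Qed.

Lemma commutatorC (R : comPzRingType) (a b : R) : commutator a b = 0.
Proof. by rewrite /commutator mulrC subrr. Qed.

Lemma racah_proper : ~ ideal_gen racah_relator 1.
Proof.
apply: relator_proper_eval0 => r; case=> [|||u|u|u];
  last (by rewrite rmorph_commutator commutatorC);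
  last (by rewrite rmorph_commutator commutatorC);
  last (by rewrite rmorph_commutator commutatorC);
  by rewrite [LHS]raddfB raddfMn /= rmorph_commutator commutatorC
     free_eval_gen
     mul0rn subr0.
Qed.

Lemma bi_proper : ~ ideal_gen bi_relator 1.
Proof.
by apply: relator_proper_eval0 => r; case=> u;
  rewrite rmorph_commutator commutatorC.
Qed.

Definition racah_pres := Presentation racah_proper.
Definition bi_pres := Presentation bi_proper.
End Presentations.

Definition racah (F : fieldType) : algType F := presented_alg (racah_pres F).
Definition racah_A F : racah F := pres_gen (racah_pres F) (inord 0).
Definition racah_B F : racah F := pres_gen (racah_pres F) (inord 1).
Definition racah_C F : racah F := pres_gen (racah_pres F) (inord 2).
Definition racah_D F : racah F := pres_gen (racah_pres F) (inord 3).

Definition bannai_ito (F : fieldType) : algType F := presented_alg (bi_pres F).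
Definition bi_X F : bannai_ito F := pres_gen (bi_pres F) (inord 0).
Definition bi_Y F : bannai_ito F := pres_gen (bi_pres F) (inord 1).
Definition bi_Z F : bannai_ito F := pres_gen (bi_pres F) (inord 2).

Definition zeta_image (F : fieldType) (S : algType F) (x : S) : S :=
  (16%:R : F)^-1 *: ((2%:R *: x - 3%:R) * (2%:R *: x + 1)).

#[local] Instance nc_ring_ops (R : nzRingType) :
  @Ncring.Ring_ops R 0 1 +%R *%R (fun x y => x - y) -%R eq := {}.
#[local] Instance nc_ring (R : nzRingType) :
  @Ncring.Ring R 0 1 +%R *%R (fun x y => x - y) -%R eq (nc_ring_ops R).
Proof.
split; rewrite /Algebra_syntax.equality /=.
- by split=> // x y z ->.
- by move=> x y -> u v ->.
- by move=> x y -> u v ->.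
- by move=> x y -> u v ->.
- by move=> x y ->.
- exact: add0r.
- exact: addrC.
- exact: addrA.
- exact: mul1r.
- exact: mulr1.
- exact: mulrA.
- exact: mulrDl.
- by move=> x y z; apply: mulrDr.
- by [].
- exact: subrr.
Qed.

Section BIIdentities.
Variables (R : nzRingType) (X Y Z : R).

Let k := anticommutator X Y - Z.
Let l := anticommutator Y Z - X.
Let m := anticommutator Z X - Y.
Hypothesis central : forall u,
  [/\ commutator k u = 0, commutator l u = 0 & commutator m u = 0].
Let a := X * X - X.
Let b := Y * Y - Y.
Let c := Z * Z - Z.
Let e := (Z * Y * X - X * Y * Z) *+ 2 + commutator X Y + commutator Y Z
         + commutator Z X.

Let cXk := commutator X k. Let cYk := commutator Y k. Let cmk := commutator m k.
Let cXl := commutator X l. Let cYl := commutator Y l. Let cZl := commutator Z l.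
Let cXm := commutator X m. Let cYm := commutator Y m. Let cZm := commutator Z m.

Let comm0 (u w : R) : commutator w u = 0 -> commutator u w = 0.
Proof. by move=> /eqP; rewrite subr_eq0 => /eqP wu; rewrite /commutator wu subrr. Qed.

Let comms0 : ((cXk = 0) * (cYk = 0) * (cmk = 0) * (cXl = 0) * (cYl = 0) *
  (cZl = 0) * (cXm = 0) * (cYm = 0) * (cZm = 0))%type.
Proof. by do !split; apply: comm0; have [] := central X; have [] := central Y;
  have [] := central Z; have [] := central m. Qed.

Ltac nc_ring_tac := rewrite ?/cXk ?/cYk ?/cmk ?/cXl ?/cYl ?/cZl ?/cXm ?/cYm
  ?/cZm ?/e ?/a ?/b ?/c ?/k ?/l ?/m /commutator /anticommutator ?mulrS ?mulr0n;
  Ncring_tac.non_commutative_ring.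

Lemma bi_comm_ab : commutator a b = e.
Proof.
have : commutator a b - e = cYk + cXl - cXk - X * cYk - cYk * X by nc_ring_tac.
by rewrite !comms0 mulr0 mul0r !subr0 addr0 => /subr0_eq.
Qed.

Lemma bi_comm_bc : commutator b c = e.
Proof.
have : commutator b c - e =
  cXl *+ 2 - cYl + cYm + cZl - Y * cZl - cZl * Y by nc_ring_tac.
by rewrite !comms0 mulr0 mul0r mul0rn !subr0 !addr0 => /subr0_eq.
Qed.

Lemma bi_comm_ca : commutator c a = e.
Proof.
have : commutator c a - e =
  X * cZm + cZm * X + cXl + cXm - cZm by nc_ring_tac.
by rewrite !comms0 mulr0 mul0r !addr0 subr0 => /subr0_eq.
Qed.

Lemma bi_sum_comm : commutator (X + Y + Z) a = 0.
Proof.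
have -> : commutator (X + Y + Z) a = - cXk - cXm by nc_ring_tac.
by rewrite !comms0 subr0 oppr0.
Qed.

(* The homomorphism maps alpha to z / 128, which is not central in the
   Bannai-Ito algebra: it only commutes with the images of A, B, C. *)
Let z := (k - m) * ((X + Y + Z) *+ 4 - 1 *+ 6 - (k + m) *+ 2).

Lemma bi_alpha : commutator a (commutator a b) + (a * c - b * a) *+ 8
  + (b - c) *+ 6 = z.
Proof.
rewrite bi_comm_ab; apply: subr0_eq.
transitivity (
    - cXk *+ 2 - cXk * X - (cXk * X * Z) *+ 2 + (cXk * Z) *+ 4
    - (cXk * Z * X) *+ 4 + X * cXk - (X * cXk * Z) *+ 2 + (m * cXk) *+ 2
    - cXl *+ 3 - (cXl * X) *+ 3 + (cXl * X * X) *+ 2 - X * cXl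
    + (X * cXl * X) *+ 2 - cXm *+ 6 + cXm * X + (cXm * X * Y) *+ 2
    - (cXm * Y) *+ 4 + (cXm * Y * X) *+ 4 - X * cXm + (X * cXm * Y) *+ 2
    - (k * cXm) *+ 2 + cYk *+ 4 - (cYk * X) *+ 6 - (X * cYk) *+ 2 - cYm *+ 6
    - (cYm * X) *+ 4 + (cYm * X * X) *+ 2 - (X * cYm) *+ 4
    + (X * cYm * X) *+ 4 + (X * X * cYm) *+ 2 + cZm *+ 4 - (cZm * X) *+ 2
    - (X * cZm) *+ 6 - cmk *+ 6 + (cmk * X) *+ 4
).
  rewrite /z; nc_ring_tac.
by rewrite !comms0 !(mulr0, mul0r, mul0rn, oppr0, subr0, addr0).
Qed.

Lemma bi_alpha_comm u : commutator (X + Y + Z) u = 0 -> commutator z u = 0.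
Proof.
have [k0 _ m0] := central u => s0.
have -> : commutator z u = (commutator k u - commutator m u)
     * ((X + Y + Z) *+ 4 - 1 *+ 6 - (k + m) *+ 2)
  + (k - m) * (commutator (X + Y + Z) u *+ 4
     - (commutator k u + commutator m u) *+ 2) by rewrite /z; nc_ring_tac.
by rewrite k0 m0 s0 !(mulr0, mul0r, mul0rn, oppr0, subr0, addr0).
Qed.

Let w (x : R) := (x * x - x) *+ 4 - 1 *+ 3.

Lemma w_factor x : (x *+ 2 - 1 *+ 3) * (x *+ 2 + 1) = w x.
Proof. by rewrite /w !mulrS !mulr0n; Ncring_tac.non_commutative_ring. Qed.

Lemma w_comm x y : commutator (w x) (w y) =
  commutator (x * x - x) (y * y - y) *+ 16.
Proof. rewrite /w /commutator !mulrS !mulr0n; Ncring_tac.non_commutative_ring. Qed.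

Lemma w_alpha : commutator (w X) (commutator (w X) (w Y))
  + (w X * w Z - w Y * w X) *+ 32 = z *+ 64.
Proof.
rewrite -bi_alpha /w -/a -/b -/c; move: a b c => a' b' c'.
rewrite /commutator !mulrS !mulr0n; Ncring_tac.non_commutative_ring.
Qed.

Lemma w_alpha_comm x : commutator (X + Y + Z) (x * x - x) = 0 ->
  commutator (commutator (w X) (commutator (w X) (w Y))
    + (w X * w Z - w Y * w X) *+ 32) (w x) = 0.
Proof.
move=> /bi_alpha_comm z0; rewrite w_alpha.
have zw : commutator z (w x) = commutator z (x * x - x) *+ 4.
  rewrite /w; move: (x * x - x) z => t u.
  by rewrite /commutator !mulrS !mulr0n; Ncring_tac.non_commutative_ring.
by rewrite /commutator mulrnAl mulrnAr -mulrnBl -/(commutator z (w x)) zw z0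
   !mul0rn.
Qed.
End BIIdentities.


Section ZetaRelations.
Variables (F : fieldType) (S : algType F) (X Y Z : S).
Hypothesis F2 : 2%N \notin [pchar F].
Hypothesis centralX : forall u,
  [/\ commutator (anticommutator X Y - Z) u = 0,
      commutator (anticommutator Y Z - X) u = 0
    & commutator (anticommutator Z X - Y) u = 0].

Let w (x : S) := (x * x - x) *+ 4 - 1 *+ 3.
Let h : F := (16%:R)^-1.

Lemma F2_neq0 : (2%:R : F) != 0.
Proof. by move: F2; rewrite inE /=. Qed.

Lemma zeta_imageE (x : S) : zeta_image x = h *: w x.
Proof.
rewrite /zeta_image /w -/h !scaler_nat; by rewrite w_factor.
Qed.

Lemma commutatorZ p q (u v : S) :
  commutator (p *: u) (q *: v) = (p * q) *: commutator u v.
Proof.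
by rewrite /commutator -!scalerAl -!scalerAr !scalerA scalerBr (mulrC q).
Qed.

Lemma zeta_comm (x y : S) : commutator (zeta_image x) (zeta_image y) =
  (h ^+ 2 *+ 16) *: commutator (x * x - x) (y * y - y).
Proof.
by rewrite !zeta_imageE commutatorZ w_comm -scalerMnr scalerMnl -expr2.
Qed.

Let A := zeta_image X.
Let B := zeta_image Y.
Let C := zeta_image Z.
Let D := (2%:R : F)^-1 *: commutator A B.

Lemma zeta_AB : commutator A B = D *+ 2.
Proof. by rewrite -scaler_nat scalerA divff ?F2_neq0 // scale1r. Qed.

Lemma zeta_BC : commutator B C = commutator A B.
Proof. by rewrite /A /B /C !zeta_comm (bi_comm_bc centralX) (bi_comm_ab centralX). Qed.

Lemma zeta_CA : commutator C A = commutator A B.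
Proof. by rewrite /A /B /C !zeta_comm (bi_comm_ca centralX) (bi_comm_ab centralX). Qed.

Lemma h32 : h ^+ 2 = h * (2%:R^-1 * (h ^+ 2)) *+ 32.
Proof.
have n2 := F2_neq0; have h16 : h * 16%:R = 1.
  by rewrite /h mulVf // (natrX F 2 4) expf_neq0.
rewrite -mulr_natr (natrM F 2 16).
rewrite [RHS](_ : _ = (2%:R^-1 * 2%:R) * (h * 16%:R) * h ^+ 2); last by ring.
by rewrite h16 mulVf // !mul1r.
Qed.

Lemma zeta_alpha (x : S) : commutator (X + Y + Z) (x * x - x) = 0 ->
  commutator (commutator A D + A * C - B * A) (zeta_image x) = 0.
Proof.
move=> s0.
have -> : commutator A D + A * C - B * A =
    (h * (2%:R^-1 * h ^+ 2)) *: (commutator (w X) (commutator (w X) (w Y))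
    + (w X * w Z - w Y * w X) *+ 32).
  have -> : D = (2%:R^-1 * h ^+ 2) *: commutator (w X) (w Y).
    by rewrite /D /A /B !zeta_imageE commutatorZ scalerA.
  rewrite /A /B /C !zeta_imageE commutatorZ [RHS]scalerDr.
  rewrite -[LHS]addrA; congr (_ + _).
  by rewrite -scalerMnr scalerMnl -h32 -!scalerAl -!scalerAr !scalerA -expr2 -scalerBr.
by rewrite zeta_imageE commutatorZ w_alpha_comm ?scaler0.
Qed.
End ZetaRelations.

Lemma free_eval_central (F : fieldType) n (S : algType F) (g : 'I_n -> S) z u :
  (forall i, commutator z (g i) = 0) -> commutator z (free_eval g u) = 0.
Proof.
move=> zg; apply/eqP; rewrite subr_eq0; apply/eqP.
rewrite -[_ = _]/(GRing.comm z (free_eval g u)) /free_eval mmapE.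
apply: commr_sum => v _ /=; apply: commrM.
  by rewrite /GRing.comm mulr_algl mulr_algr.
by apply: commr_prod => i _; apply/eqP; rewrite -subr_eq0; apply/eqP/zg.
Qed.

Lemma bi_central (F : fieldType) (u : bannai_ito F) :
  [/\ commutator (anticommutator (bi_X F) (bi_Y F) - bi_Z F) u = 0,
      commutator (anticommutator (bi_Y F) (bi_Z F) - bi_X F) u = 0
    & commutator (anticommutator (bi_Z F) (bi_X F) - bi_Y F) u = 0].
Proof.
have [x ->] := pres_pi_surj u.
pose p : {rmorphism _ -> _} := pres_pi (bi_pres F).
have pE (v y t : free_alg F 3) : p (commutator (anticommutator v y - t) x)
    = commutator (anticommutator (p v) (p y) - p t) (p x).
  by rewrite rmorph_commutator rmorphB rmorph_anticommutator.
have p0 r : bi_relator r -> p r = 0.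
  by move=> rr; apply/pres_pi_eq0/ideal_gen_incl.
pose X := @free_gen F 3 (inord 0); pose Y := @free_gen F 3 (inord 1).
pose Z := @free_gen F 3 (inord 2).
split.
- exact: etrans (esym (pE X Y Z)) (p0 _ (bi_kappa x)).
- exact: etrans (esym (pE Y Z X)) (p0 _ (bi_lambda x)).
- exact: etrans (esym (pE Z X Y)) (p0 _ (bi_mu x)).
Qed.

Section ZetaExists.
Variables (F : fieldType) (S : algType F) (X Y Z : S).
Hypothesis F2 : 2%N \notin [pchar F].
Hypothesis H : forall u,
  [/\ commutator (anticommutator X Y - Z) u = 0,
      commutator (anticommutator Y Z - X) u = 0
    & commutator (anticommutator Z X - Y) u = 0].

Lemma racah_hom_exists : exists f : {lrmorphism racah F -> S},
  [/\ f (racah_A F) = zeta_image X, f (racah_B F) = zeta_image Y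
    & f (racah_C F) = zeta_image Z].
Proof.
have H1 u : [/\ commutator (anticommutator Y Z - X) u = 0,
   commutator (anticommutator Z X - Y) u = 0
   & commutator (anticommutator X Y - Z) u = 0] by have [] := H u.
have H2 u : [/\ commutator (anticommutator Z X - Y) u = 0,
   commutator (anticommutator X Y - Z) u = 0
   & commutator (anticommutator Y Z - X) u = 0] by have [] := H u.
have sX : commutator (X + Y + Z) (X * X - X) = 0 by exact: bi_sum_comm H.
have sY : commutator (X + Y + Z) (Y * Y - Y) = 0.
  by rewrite -addrA addrC; exact: bi_sum_comm H1.
have sZ : commutator (X + Y + Z) (Z * Z - Z) = 0.
  by rewrite addrC addrA; exact: bi_sum_comm H2.
pose A := zeta_image X; pose B := zeta_image Y; pose C := zeta_image Z.
pose D := (2%:R : F)^-1 *: commutator A B.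
pose g (i : 'I_4) := nth 0 [:: A; B; C; D] i.
have gA : g (inord 0) = A by rewrite /g inordK.
have gB : g (inord 1) = B by rewrite /g inordK.
have gC : g (inord 2) = C by rewrite /g inordK.
have gD : g (inord 3) = D by rewrite /g inordK.
have AB : commutator A B = D *+ 2 by exact: zeta_AB.
have BC : commutator B C = commutator A B by exact: zeta_BC.
have CA : commutator C A = commutator A B by exact: zeta_CA.
have commD z : commutator z A = 0 -> commutator z B = 0 -> commutator z D = 0.
  move=> /eqP; rewrite subr_eq0 => /eqP zA /eqP; rewrite subr_eq0 => /eqP zB.
  apply/eqP; rewrite subr_eq0; apply/eqP.
  rewrite /D -scalerAl -scalerAr; congr (_ *: _).
  have cA : GRing.comm z A by []; have cB : GRing.comm z B by [].
  by apply: commrB; apply: commrM.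
have central4 z : commutator z A = 0 -> commutator z B = 0 ->
    commutator z C = 0 -> forall u, commutator z (free_eval g u) = 0.
  move=> zA zB zC u; apply: free_eval_central => i; rewrite /g.
  by case: i => -[|[|[|[|i]]]] //= _; exact: commD.
have alpha0 u : commutator (commutator A D + A * C - B * A) (free_eval g u) = 0.
  by apply: central4; apply: zeta_alpha.
have beta0 u : commutator (commutator B D + B * A - C * B) (free_eval g u) = 0.
  rewrite /D -BC; apply: central4; apply: (zeta_alpha F2 H1);
  by rewrite addrC addrA.
have gamma0 u : commutator (commutator C D + C * B - A * C) (free_eval g u) = 0.
  rewrite /D -CA; apply: central4; apply: (zeta_alpha F2 H2);
  by rewrite -addrA addrC.
have [|zeta zetaE] := @presented_alg_lift F 4 _ g (racah_pres F).
  pose f : {rmorphism free_alg F 4 -> S} := free_eval g.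
  have evD x y t : f (commutator x y - t *+ 2)
      = commutator (f x) (f y) - f t *+ 2.
    by rewrite rmorphB rmorphMn rmorph_commutator.
  have evA x y t v u : f (commutator (commutator x y + x * t - v * x) u)
      = commutator (commutator (f x) (f y) + f x * f t - f v * f x) (f u).
    by rewrite rmorph_commutator rmorph_racah_relation.
  have [fA fB fC fD] : [/\ f (free_gen F (inord 0)) = A,
      f (free_gen F (inord 1)) = B, f (free_gen F (inord 2)) = C
    & f (free_gen F (inord 3)) = D].
    by split; apply: etrans (free_eval_gen g _) _.
  move=> r; rewrite -[free_eval g r]/(f r); case=> [|||u|u|u].
  - by rewrite evD fA fB fD AB subrr.
  - by rewrite evD fB fC fD BC AB subrr.
  - by rewrite evD fC fA fD CA AB subrr.
  - by rewrite evA fA fB fC fD; apply: alpha0.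
  - by rewrite evA fA fB fC fD; apply: beta0.
  - by rewrite evA fA fB fC fD; apply: gamma0.
by exists zeta; split; rewrite zetaE.
Qed.
End ZetaExists.

Lemma zeta_exists (F : fieldType) : 2%N \notin [pchar F] ->
  exists zeta : {lrmorphism racah F -> bannai_ito F},
    [/\ zeta (racah_A F) = zeta_image (bi_X F),
        zeta (racah_B F) = zeta_image (bi_Y F)
      & zeta (racah_C F) = zeta_image (bi_Z F)].
Proof. by move=> F2; apply: racah_hom_exists F2 (@bi_central F). Qed.

(* Main.v *)
(** The Racah algebra is spanned by the ordered monomials
    A^i B^j D^k delta^l alpha^m beta^n, where delta = A + B + C, so it suffices
    to show that their images are linearly independent.  For this the
    Bannai-Ito algebra acts on two-sided sequences with coefficients in K[t]:
    X is upper bidiagonal, Y lower bidiagonal and Z tridiagonal, with entries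
    of degree at most one in t that depend on five free parameters.  Top
    coefficients in t turn X, Y, Z into 2 x 2 matrices over K which generate a
    Clifford algebra (the sixth parameter, xi, is the eigenvalue of the shift
    by two steps), and the images of A, B, delta, D, alpha, beta, given the
    weights 2, 2, 2, 3, 4, 4, become scalar matrices.  It remains to see that
    these six scalars are algebraically independent; taking for the parameters
    powers of T in K = F(T) with rapidly increasing exponents, distinct
    monomials in them have distinct degrees in T. *)
Require Import Defs.
From HB Require Import structures.
From mathcomp Require Import all_boot all_order all_algebra.
From mathcomp Require Import boolp functions ring zify.
From mathcomp Require Import finmap.
From mathcomp.multinomials Require Import monalg.
Set Implicit Arguments.
Unset Strict Implicit.
Unset Printing Implicit Defensive.
Import GRing.Theory.
Local Open Scope ring_scope.

(** * The algebra of linear operators on two-sided sequences *)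

Definition two_chain (R : nzRingType) : Type := bool * int -> R^o.
HB.instance Definition _ (R : nzRingType) := GRing.Lmodule.on (two_chain R).

Section LinearOperators.
Variables (F : fieldType) (R : comNzRingType) (phi : {rmorphism F -> R}).
Local Notation V := (two_chain R).

Record linop : Type := LinOp { op_fun :> V -> V; op_linear : linear op_fun }.

HB.instance Definition _ := gen_eqMixin linop.
HB.instance Definition _ := gen_choiceMixin linop.

Lemma linopP (M N : linop) : M =1 N -> M = N.
Proof.
case: M N => [f fL] [g gL] /= /funext fg; subst g.
by congr LinOp; apply: Prop_irrelevance.
Qed.

Lemma linopD (M : linop) f g : M (f + g) = M f + M g.
Proof. by rewrite -[f in LHS]scale1r op_linear scale1r. Qed.

Lemma linop0 (M : linop) : M 0 = 0.
Proof. by apply: (addrI (M 0)); rewrite -linopD !addr0. Qed.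

Lemma linopZ (M : linop) c f : M (c *: f) = c *: M f.
Proof. by rewrite -[X in M X]addr0 op_linear linop0 addr0. Qed.

Lemma linear_zero : linear (fun _ : V => 0 : V).
Proof. by move=> c f g; rewrite scaler0 addr0. Qed.
Lemma linear_add (M N : linop) : linear (fun f => M f + N f).
Proof. by move=> c f g; rewrite !op_linear scalerDr addrACA. Qed.
Lemma linear_opp (M : linop) : linear (fun f => - M f).
Proof. by move=> c f g; rewrite op_linear opprD scalerN. Qed.
Lemma linear_comp (M N : linop) : linear (fun f => M (N f)).
Proof. by move=> c f g; rewrite !op_linear. Qed.
Lemma linear_scale (r : R) (M : linop) : linear (fun f => r *: M f).
Proof. by move=> c f g; rewrite op_linear scalerDr !scalerA mulrC. Qed.
Lemma linear_one : linear (fun f : V => f). Proof. by []. Qed.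

Definition op_zero := LinOp linear_zero.
Definition op_add M N := LinOp (linear_add M N).
Definition op_opp M := LinOp (linear_opp M).
Definition op_one := LinOp linear_one.
Definition op_mul M N := LinOp (linear_comp M N).
Definition op_scale r M := LinOp (linear_scale r M).

Lemma op_addA : associative op_add.
Proof. by move=> M N P; apply/linopP => f /=; rewrite addrA. Qed.
Lemma op_addC : commutative op_add.
Proof. by move=> M N; apply/linopP => f /=; rewrite addrC. Qed.
Lemma op_add0 : left_id op_zero op_add.
Proof. by move=> M; apply/linopP => f /=; rewrite add0r. Qed.
Lemma op_addN : left_inverse op_zero op_opp op_add.
Proof. by move=> M; apply/linopP => f /=; rewrite addNr. Qed.
HB.instance Definition _ :=
  GRing.isZmodule.Build linop op_addA op_addC op_add0 op_addN.

Lemma op_mulA : associative op_mul.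
Proof. by move=> M N P; apply/linopP. Qed.
Lemma op_mul1 : left_id op_one op_mul.
Proof. by move=> M; apply/linopP. Qed.
Lemma op_mulr1 : right_id op_one op_mul.
Proof. by move=> M; apply/linopP. Qed.
Lemma op_mulDl : left_distributive op_mul +%R.
Proof. by move=> M N P; apply/linopP. Qed.
Lemma op_mulDr : right_distributive op_mul +%R.
Proof. by move=> M N P; apply/linopP => f /=; rewrite linopD. Qed.
Lemma op_one_neq0 : op_one != 0.
Proof.
apply/eqP => /(congr1 (fun M : linop => M (fun=> 1) (true, 0))) /eqP.
by rewrite oner_eq0.
Qed.
HB.instance Definition _ := GRing.Zmodule_isNzRing.Build linop
  op_mulA op_mul1 op_mulr1 op_mulDl op_mulDr op_one_neq0.

Definition op_scaleF (c : F) (M : linop) := op_scale (phi c) M.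
Lemma op_scaleA a b M : op_scaleF a (op_scaleF b M) = op_scaleF (a * b) M.
Proof. by apply/linopP => f /=; rewrite scalerA rmorphM. Qed.
Lemma op_scale1 : left_id 1 op_scaleF.
Proof. by move=> M; apply/linopP => f /=; rewrite rmorph1 scale1r. Qed.
Lemma op_scaleDr : right_distributive op_scaleF +%R.
Proof. by move=> a M N; apply/linopP => f /=; rewrite scalerDr. Qed.
Lemma op_scaleDl M : {morph op_scaleF^~ M : a b / a + b}.
Proof. by move=> a b; apply/linopP => f /=; rewrite rmorphD scalerDl. Qed.

(* The useless [let] makes [phi] a parameter of the type, from which the
   F-algebra structure can be inferred. *)
Definition linalg : Type := let _ := phi in linop.
HB.instance Definition _ := GRing.NzRing.on linalg.
HB.instance Definition _ := GRing.Zmodule_isLmodule.Build F linalg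
  op_scaleA op_scale1 op_scaleDr op_scaleDl.
Lemma linalg_scaleAl (c : F) (M N : linalg) : c *: (M * N) = (c *: M) * N.
Proof. by apply/linopP. Qed.
HB.instance Definition _ := GRing.Lmodule_isLalgebra.Build F linalg
  linalg_scaleAl.
Lemma linalg_scaleAr (c : F) (M N : linalg) : c *: (M * N) = M * (c *: N).
Proof. by apply/linopP => f /=; rewrite linopZ. Qed.
HB.instance Definition _ := GRing.Lalgebra_isAlgebra.Build F linalg
  linalg_scaleAr.
End LinearOperators.

(** * A five-parameter family of modules over the Bannai-Ito algebra *)

(* The pair [(b, m)] stands for the integer [n = 2 m + b].  Eigenvalues of [X]
   and [Y] on consecutive positions add up to [+- 2 h]; the relations hold as
   soon as [2 h = 1], and keeping [h] formal avoids all denominators.  The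
   entries [up] and [down] come from factoring into linear factors the product
   [up n * down (n + 1)], a quadratic polynomial in [n] that the relations
   determine. *)
Section BannaiItoModule.
Variables (F : fieldType) (R : comNzRingType) (phi : {rmorphism F -> R}).
Variables (h x y z r s : R).
Local Notation V := (two_chain R).
Local Notation S := (linalg phi).

Definition next (i : bool * int) : bool * int :=
  if i.1 then (false, i.2 + 1) else (true, i.2).
Definition prev (i : bool * int) : bool * int :=
  if i.1 then (false, i.2) else (true, i.2 - 1).

Lemma nextK : cancel next prev.
Proof. by case=> -[] m; rewrite /next /prev //= addrK. Qed.
Lemma prevK : cancel prev next.
Proof. by case=> -[] m; rewrite /next /prev //= subrK. Qed.

Definition altern (b : bool) : R := if b then -1 else 1.
Definition pos (i : bool * int) : R := (i.2)%:~R *+ 2 + (i.1)%:R.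

Lemma pos_next i : pos (next i) = pos i + 1.
Proof. by case: i => -[] m; rewrite /pos /next /= ?rmorphD /=; ring. Qed.
Lemma pos_prev i : pos (prev i) = pos i - 1.
Proof. by rewrite -[i in RHS]prevK pos_next addrK. Qed.
Lemma altern_next i : altern (next i).1 = - altern i.1.
Proof. by case: i => -[] m; rewrite /altern /next /= ?opprK. Qed.
Lemma altern_prev i : altern (prev i).1 = - altern i.1.
Proof. by case: i => -[] m; rewrite /altern /prev /= ?opprK. Qed.

Definition up (i : bool * int) : R :=
  h *+ 2 * (pos i + 1) + (if i.1 then s else r).
Definition down (i : bool * int) : R :=
  - (h *+ 2 * pos i) + (if i.1 then r + x + y + h *+ 2 + z
                        else s + x + y + h *+ 2 - z).

Definition x_fun (f : V) : V := fun i =>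
  altern i.1 * (x - h *+ 2 * pos i) * f i + up i * f (next i).
Definition y_fun (f : V) : V := fun i =>
  altern i.1 * (y - h *+ 2 * pos i) * f i + down i * f (prev i).
Definition z_fun (f : V) : V := fun i =>
  (altern i.1 * z - h) * f i
  + altern i.1 * (up i * f (next i) - down i * f (prev i)).

Lemma x_fun_linear : linear x_fun.
Proof.
move=> c f g; apply/funext => i.
change (x_fun (c *: f + g) i = c * x_fun f i + x_fun g i).
by rewrite /x_fun /= -![(c *: f + g) _]/(c * f _ + g _); ring.
Qed.
Lemma y_fun_linear : linear y_fun.
Proof.
move=> c f g; apply/funext => i.
change (y_fun (c *: f + g) i = c * y_fun f i + y_fun g i).
by rewrite /y_fun /= -![(c *: f + g) _]/(c * f _ + g _); ring.
Qed.
Lemma z_fun_linear : linear z_fun.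
Proof.
move=> c f g; apply/funext => i.
change (z_fun (c *: f + g) i = c * z_fun f i + z_fun g i).
by rewrite /z_fun /= -![(c *: f + g) _]/(c * f _ + g _); ring.
Qed.

Definition x_op : S := LinOp x_fun_linear.
Definition y_op : S := LinOp y_fun_linear.
Definition z_op : S := LinOp z_fun_linear.

(** [phi0] is [up] at position -1 times [down] at 0, and [phi1] is [up] at 0 times [down] at 1;
    these two values fix the quadratic polynomial formed by the products of consecutive entries. *)
Definition phi0 := s * (s + x + y + h *+ 2 - z).
Definition phi1 := (h *+ 2 + r) * (r + x + y + z).
Definition kappa := phi0 + phi1 + x * y *+ 2 - h *+ 2 * (z - h).
Definition mu := x * (z - h) *+ 2 + (phi1 - phi0) - h *+ 2 * y.
Definition lambda := mu + (y - x) * z *+ 2.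

Lemma xy_fun f i :
  x_fun (y_fun f) i + y_fun (x_fun f) i = h *+ 2 * z_fun f i + kappa * f i.
Proof.
rewrite /x_fun /y_fun /z_fun !nextK !prevK !altern_next !altern_prev.
rewrite /up /down !pos_next !pos_prev /kappa /phi0 /phi1.
by case: i => -[] m; rewrite /altern /=; ring.
Qed.
(** Terms that reach two positions away cancel because [altern] changes sign at each step. *)
Lemma zx_fun f i :
  z_fun (x_fun f) i + x_fun (z_fun f) i = h *+ 2 * y_fun f i + mu * f i.
Proof.
rewrite /x_fun /y_fun /z_fun !nextK !prevK !altern_next !altern_prev.
rewrite /up /down !pos_next !pos_prev /mu /phi0 /phi1.
by case: i => -[] m; rewrite /altern /=; ring.
Qed.
Lemma yz_fun f i :
  y_fun (z_fun f) i + z_fun (y_fun f) i = h *+ 2 * x_fun f i + lambda * f i.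
Proof.
rewrite /x_fun /y_fun /z_fun !nextK !prevK !altern_next !altern_prev.
rewrite /up /down !pos_next !pos_prev /lambda /mu /phi0 /phi1.
by case: i => -[] m; rewrite /altern /=; ring.
Qed.
End BannaiItoModule.

(** * Symbols *)

Section TopCoefficient.
Variable K : fieldType.
Implicit Types p q : {poly K}.

(** Degree at most [d], not exactly [d]: since [c] may be 0, sums whose top terms cancel need no
    case distinction. *)
Definition top d p c := (forall j, (d < j)%N -> p`_j = 0) /\ p`_d = c.

Lemma topD d p q a b : top d p a -> top d q b -> top d (p + q) (a + b).
Proof.
move=> [p0 <-] [q0 <-]; split=> [j dj|]; rewrite coefD //.
by rewrite p0 // q0 // addr0.
Qed.

Lemma topN d p a : top d p a -> top d (- p) (- a).
Proof.
by move=> [p0 <-]; split=> [j dj|]; rewrite coefN // p0 // oppr0.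
Qed.

Lemma top_raise d e p a : (d < e)%N -> top d p a -> top e p 0.
Proof. by move=> de [p0 _]; split=> [j ej|]; apply: p0; lia. Qed.

Lemma topM d e p q a b :
  top d p a -> top e q b -> top (d + e) (p * q) (a * b).
Proof.
move=> [p0 <-] [q0 <-]; split=> [j dj|]; rewrite coefM.
  rewrite big1 // => i _; have [di|id] := ltnP d i.
    by rewrite p0 // mul0r.
  by rewrite q0 ?mulr0 //; lia.
have id : (d < (d + e).+1)%N by lia.
rewrite (bigD1 (Ordinal id)) //= addKn big1 ?addr0 // => i.
rewrite -val_eqE /= => ni.
have [di|ed] := ltnP d i; first by rewrite p0 // mul0r.
by rewrite q0 ?mulr0 //; lia.
Qed.

Lemma topC c : top 0 c%:P c.
Proof. by split=> [[|j]|] //; rewrite coefC. Qed.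

Lemma topX c : top 1 (c *: 'X) c.
Proof.
split=> [[|[|j]]|] //; rewrite coefZ coefX ?mulr0 ?mulr1 //.
Qed.

Lemma top_uniq d p a b : top d p a -> top d p b -> a = b.
Proof. by move=> [_ <-] [_ <-]. Qed.

Lemma top0 d : top d 0 0.
Proof. by split=> [j _|]; rewrite coef0. Qed.
End TopCoefficient.

Section Symbols.
Variables (F : fieldType) (K : fieldType) (iota : {rmorphism F -> K}).
Variable xi : K.
Local Notation R := {poly K}.
Definition scalars : F -> R := polyC \o iota.
HB.instance Definition _ := GRing.RMorphism.on scalars.
Local Notation S := (linalg scalars).

(* Top coefficients of [f] are required to form a geometric progression of
   ratio [xi] on either parity class, hence are recorded by a pair. *)
Definition lead d (f : two_chain R) (u : K * K) :=
  forall i, top d (f i) ((if i.1 then u.2 else u.1) * xi ^ i.2).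

(** [M] raises the degree in t by at most [w], and [s] is its principal symbol in that weight,
    possibly zero. *)
Definition symbol w (M : S) (s : K * K -> K * K) :=
  forall d f u, lead d f u -> lead (d + w) (M f) (s u).

Definition dilate (c : K) (u : K * K) := (c * u.1, c * u.2).

Lemma symbolM w1 w2 M N s t : symbol w1 M s -> symbol w2 N t ->
  symbol (w1 + w2) (M * N) (fun u => s (t u)).
Proof.
move=> sM tN d f u fu; have -> : (d + (w1 + w2) = d + w2 + w1)%N by lia.
exact/sM/tN.
Qed.

Lemma symbolD w M N s t : symbol w M s -> symbol w N t ->
  symbol w (M + N) (fun u => s u + t u).
Proof.
move=> sM tN d f u fu i.
have := topD (sM _ _ _ fu i) (tN _ _ _ fu i).
by case: i.1; rewrite /= -mulrDl.
Qed.

Lemma symbolN w M s : symbol w M s -> symbol w (- M) (fun u => - s u).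
Proof.
move=> sM d f u fu i; have := topN (sM _ _ _ fu i).
by case: i.1; rewrite /= -mulNr.
Qed.

(** An operator of smaller order is invisible in weight [v]; this is how linear terms and constants
    drop out below. *)
Lemma symbol_raise w v M s : (w < v)%N -> symbol w M s ->
  symbol v M (fun=> 0).
Proof.
move=> wv sM d f u fu i; have := top_raise _ (sM _ _ _ fu i).
move=> /(_ (d + v)%N); rewrite ltn_add2l => /(_ wv).
by case: i.1; rewrite mul0r.
Qed.

Lemma symbolZ w M s c : symbol w M s ->
  symbol w (c *: M) (fun u => dilate (iota c) (s u)).
Proof.
move=> sM d f u fu i; have := topM (topC (iota c)) (sM _ _ _ fu i).
by case: i.1; rewrite /= mulrA.
Qed.

Lemma symbol1 : symbol 0 1 id.
Proof. by move=> d f u fu i; rewrite addn0; exact: fu. Qed.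

Lemma symbol0 w : symbol w 0 (fun=> 0).
Proof. by move=> d f u _ i; case: i.1; rewrite mul0r; exact: top0. Qed.

Lemma eq_symbol w M s t : s =1 t -> symbol w M s -> symbol w M t.
Proof. by move=> /funext ->. Qed.
Lemma symbol_nat w M s n :
  symbol w M s -> symbol w (M *+ n) (fun u => s u *+ n).
Proof.
move=> sM; elim: n => [|n IHn]; first exact: symbol0.
rewrite mulrS; apply: eq_symbol (symbolD sM IHn) => u.
by rewrite mulrS.
Qed.
End Symbols.

Section ModuleSymbols.
Variables (F : fieldType) (K : fieldType) (iota : {rmorphism F -> K}).
Variables (xi x y z r s : K) (h : F).
Hypothesis xi0 : xi != 0.
Local Notation "c 't'" := (c *: 'X : {poly K}) (at level 2, format "c  't'").
Local Notation H := (scalars iota h).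
Local Notation X := (x_op (scalars iota) H x t r t s t).
Local Notation Y := (y_op (scalars iota) H x t y t z t r t s t).
Local Notation Z := (z_op (scalars iota) H x t y t z t r t s t).
Local Notation sym := (symbol (iota := iota) xi).

Lemma top_affine c (e : K) : top 1 (c t + e%:P) c.
Proof.
rewrite -[c in X in top _ _ X]addr0.
by apply: topD (topX c) (top_raise _ (topC e)).
Qed.

Lemma pos_const i : pos {poly K} i = (pos K i)%:P.
Proof. by rewrite /pos polyCD polyCMn rmorph_int rmorph_nat. Qed.

Lemma altern_const b : altern {poly K} b = (altern K b)%:P.
Proof. by case: b; rewrite /altern ?polyCN. Qed.

Lemma spacing_const : H = (iota h)%:P. Proof. by []. Qed.

(** The position enters only through a term constant in t, so the top coefficient depends on [i] by
    its parity alone. The same holds for [up] and [down]. *)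
Lemma diagonal_top c i : top 1 (altern _ i.1 * (c t - H *+ 2 * pos _ i))
  (altern K i.1 * c).
Proof.
rewrite altern_const pos_const spacing_const -polyCMn -polyCM -polyCN.
exact: topM (topC _) (top_affine _ _).
Qed.

Lemma up_top i : top 1 (up H r t s t i) (if i.1 then s else r).
Proof.
rewrite /up pos_const spacing_const -polyCMn -(polyCD _ 1) -polyCM addrC.
by case: i.1; exact: top_affine.
Qed.

Lemma down_top i : top 1 (down H x t y t z t r t s t i)
  (if i.1 then r + x + y + z else s + x + y - z).
Proof.
rewrite /down pos_const spacing_const -polyCMn -polyCM -polyCN addrC.
set e := - _.
case: i.1.
  have -> : r t + x t + y t + (iota h *+ 2)%:P + z t
    = (r + x + y + z) t + (iota h *+ 2)%:P by rewrite !scalerDl addrAC.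
  by rewrite -addrA -polyCD; exact: top_affine.
have -> : s t + x t + y t + (iota h *+ 2)%:P - z t
  = (s + x + y - z) t + (iota h *+ 2)%:P by rewrite !scalerDl scaleNr addrAC.
by rewrite -addrA -polyCD; exact: top_affine.
Qed.

(** The three symbols are traceless 2 x 2 matrices, hence the anticommutator of any two of them is a
    scalar. *)
Definition x_sym (u : K * K) := (x * u.1 + r * u.2, s * xi * u.1 - x * u.2).
Definition y_sym (u : K * K) :=
  (y * u.1 + (s + x + y - z) / xi * u.2, (r + x + y + z) * u.1 - y * u.2).
Definition z_sym (u : K * K) :=
  (z * u.1 + (r - (s + x + y - z) / xi) * u.2,
   (r + x + y + z - s * xi) * u.1 - z * u.2).

Lemma top_eq d (p : {poly K}) a b : top d p a -> a = b -> top d p b.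
Proof. by move=> ? <-. Qed.

(** The step from an odd position to the next even one raises the second index, which costs a factor
    [xi]; the step from even to odd keeps it. *)
Lemma next_coef i (u : K * K) :
  (if (next i).1 then u.2 else u.1) * xi ^ (next i).2
  = (if i.1 then xi * u.1 else u.2) * xi ^ i.2.
Proof.
case: i => -[] m //=.
by rewrite expfzDr // expr1z (mulrC (_ ^ _)) mulrA (mulrC u.1).
Qed.

Lemma prev_coef i (u : K * K) :
  (if (prev i).1 then u.2 else u.1) * xi ^ (prev i).2
  = (if i.1 then u.1 else u.2 / xi) * xi ^ i.2.
Proof.
by case: i => -[] m //=; rewrite expfzDr // exprN1 (mulrC (_ ^ _)) mulrA.
Qed.

Lemma x_symbol : sym 1 X x_sym.
Proof.
move=> d f u fu i; rewrite addnC.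
have := topD (topM (diagonal_top x i) (fu i)) (topM (up_top i) (fu (next i))).
rewrite next_coef => /top_eq; apply.
by case: i => -[] m; rewrite /altern /=; ring.
Qed.

Lemma y_symbol : sym 1 Y y_sym.
Proof.
move=> d f u fu i; rewrite addnC.
have := topD (topM (diagonal_top y i) (fu i)) (topM (down_top i) (fu (prev i))).
rewrite prev_coef => /top_eq; apply.
by case: i => -[] m; rewrite /altern /=; ring.
Qed.

Lemma z_symbol : sym 1 Z z_sym.
Proof.
move=> d f u fu i; rewrite addnC.
have tz : top 1 (altern _ i.1 * z t - H) (altern K i.1 * z).
  rewrite altern_const spacing_const -polyCN -mul_polyC mulrA -polyCM mul_polyC.
  exact: top_affine.
have ta : top 0 (altern {poly K} i.1) (altern K i.1).
  by rewrite altern_const; exact: topC.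
have := topD (topM tz (fu i)) (topM ta (topD (topM (up_top i) (fu (next i)))
  (topN (topM (down_top i) (fu (prev i)))))).
rewrite next_coef prev_coef => /top_eq; apply.
by case: i {tz ta} => -[] m; rewrite /altern /=; ring.
Qed.
End ModuleSymbols.

(** * Images of the Racah elements in terms of X, Y, Z, and their symbols *)

Section RacahImages.
Variables (F : fieldType) (S : algType F) (X Y Z : S).
Hypothesis F2 : 2%N \notin [pchar F].
Hypothesis central : forall u,
  [/\ commutator (anticommutator X Y - Z) u = 0,
      commutator (anticommutator Y Z - X) u = 0
    & commutator (anticommutator Z X - Y) u = 0].
Local Notation A := (zeta_image X).
Local Notation B := (zeta_image Y).
Local Notation C := (zeta_image Z).
Local Notation k := (anticommutator X Y - Z).
Local Notation m := (anticommutator Z X - Y).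
Local Notation c16 := ((16%:R : F)^-1).
Local Notation D := ((2%:R : F)^-1 *: commutator A B).

Let w (x : S) := (x * x - x) *+ 4 - 1 *+ 3.

(** A commutator of two operators of order 2 has order 4 at first sight; the right-hand side has
    visible order 3. *)
Lemma image_D : D = (2%:R^-1 * (c16 ^+ 2 *+ 16)) *:
  ((Z * Y * X - X * Y * Z) *+ 2 + commutator X Y + commutator Y Z
   + commutator Z X).
Proof. by rewrite zeta_comm (bi_comm_ab central) scalerA. Qed.

(** [commutator A D] has order 5 at first sight; as a product of two factors of order 2 the whole
    element has order only 4. *)
Lemma image_alpha : commutator A D + A * C - B * A =
  (c16 * (2%:R^-1 * c16 ^+ 2) *+ 64) *:
  ((k - m) * ((X + Y + Z) *+ 4 - 1 *+ 6 - (k + m) *+ 2)).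
Proof.
rewrite -scalerMnl scalerMnr -(w_alpha central) -/(w X) -/(w Y) -/(w Z).
have -> : D = (2%:R^-1 * c16 ^+ 2) *: commutator (w X) (w Y).
  by rewrite !zeta_imageE -/(w X) -/(w Y) commutatorZ scalerA.
rewrite !zeta_imageE -/(w X) -/(w Y) -/(w Z) commutatorZ.
rewrite [RHS]scalerDr -[LHS]addrA; congr (_ + _).
rewrite -scalerMnr scalerMnl -h32 // -!scalerAl -!scalerAr !scalerA -expr2.
by rewrite -scalerBr.
Qed.
End RacahImages.

Section ImageSymbols.
Variables (F : fieldType) (K : fieldType) (iota : {rmorphism F -> K}).
Variable xi : K.
Local Notation S := (linalg (scalars iota)).
Local Notation sym := (symbol (iota := iota) xi).
Variables (X Y Z : S) (px py pz : K * K -> K * K).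
Hypotheses (sX : sym 1 X px) (sY : sym 1 Y py) (sZ : sym 1 Z pz).

Lemma symbol_low w (M N : S) p :
  sym w M p -> sym w N (fun=> 0) -> sym w (M + N) p.
Proof.
by move=> sM sN; apply: eq_symbol (symbolD sM sN) => u; rewrite addr0.
Qed.

Lemma symbol_square : sym 2 (zeta_image X)
  (fun u => dilate (iota (16%:R^-1)) (px (px u) *+ 4)).
Proof.
rewrite zeta_imageE; apply/symbolZ; apply: symbol_low.
  apply: symbol_nat; apply: symbol_low; first exact: (symbolM sX sX).
  by apply: (@symbol_raise _ _ _ _ 1%N) => //; exact: symbolN sX.
by apply: (@symbol_raise _ _ _ _ 0%N) => //; exact/symbolN/symbol_nat/symbol1.
Qed.

Lemma symbol_commutator w v M N p q : sym w M p -> sym v N q ->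
  sym (w + v) (commutator M N) (fun u => p (q u) - q (p u)).
Proof.
move=> sM sN; apply: (symbolD (symbolM sM sN)).
by rewrite addnC; exact: symbolN (symbolM sN sM).
Qed.

Lemma symbol_kappa : sym 2 (anticommutator X Y - Z)
  (fun u => px (py u) + py (px u)).
Proof.
apply: symbol_low; first exact: (symbolD (symbolM sX sY) (symbolM sY sX)).
by apply: (@symbol_raise _ _ _ _ 1%N) => //; exact: symbolN sZ.
Qed.

(** The three commutators have order 2 and do not reach weight 3. *)
Lemma symbol_e : sym 3 ((Z * Y * X - X * Y * Z) *+ 2 + commutator X Y
    + commutator Y Z + commutator Z X)
  (fun u => (pz (py (px u)) - px (py (pz u))) *+ 2).
Proof.
have sC M N p q : sym 1 M p -> sym 1 N q -> sym 3 (commutator M N) (fun=> 0).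
  by move=> sM sN; apply: symbol_raise (symbol_commutator sM sN).
apply: symbol_low (sC _ _ _ _ sZ sX).
apply: symbol_low (sC _ _ _ _ sY sZ).
apply: symbol_low (sC _ _ _ _ sX sY).
apply: symbol_nat; apply: symbolD; first exact: symbolM (symbolM sZ sY) sX.
exact: symbolN (symbolM (symbolM sX sY) sZ).
Qed.
End ImageSymbols.

Section AlphaSymbol.
Variables (F : fieldType) (K : fieldType) (iota : {rmorphism F -> K}).
Variable xi : K.
Local Notation S := (linalg (scalars iota)).
Local Notation sym := (symbol (iota := iota) xi).
Variables (X Y Z : S) (px py pz : K * K -> K * K).
Hypotheses (sX : sym 1 X px) (sY : sym 1 Y py) (sZ : sym 1 Z pz).
Local Notation k := (anticommutator X Y - Z).
Local Notation m := (anticommutator Z X - Y).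
Variables ka mu : K.
Hypothesis kaE : forall u, px (py u) + py (px u) = dilate ka u.
Hypothesis muE : forall u, pz (px u) + px (pz u) = dilate mu u.

(** [X + Y + Z] has order 1 only, so the top part is [ka - mu] times [- (ka + mu) *+ 2]. *)
Lemma symbol_alpha : sym 4
  ((k - m) * ((X + Y + Z) *+ 4 - 1 *+ 6 - (k + m) *+ 2))
  (dilate ((mu ^+ 2 - ka ^+ 2) *+ 2)).
Proof.
have sk : sym 2 k (dilate ka).
  by apply: eq_symbol (symbol_kappa sX sY sZ) => u; rewrite kaE.
have sm : sym 2 m (dilate mu).
  by apply: eq_symbol (symbol_kappa sZ sX sY) => u; rewrite muE.
have s1 := symbolD sk (symbolN sm).
have s2 := symbolN (symbol_nat 2 (symbolD sk sm)).
have s3 : sym 2 ((X + Y + Z) *+ 4 - 1 *+ 6) (fun=> 0).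
  apply: (@symbol_raise _ _ _ _ 1%N) => //.
  apply: symbol_low.
    exact: symbol_nat (symbolD (symbolD sX sY) sZ).
  apply: (@symbol_raise _ _ _ _ 0%N) => //.
  exact: symbolN (symbol_nat 6 (@symbol1 _ _ _ _)).
apply: eq_symbol (symbolM s1 (symbolD s3 s2)) => u.
by congr pair; rewrite /dilate /=; ring.
Qed.
End AlphaSymbol.

(** * Spanning monomials of the Racah algebra *)

Notation exponent := (nat * nat * nat * nat * nat * nat)%type.

Section RacahSpan.
Variables (F : fieldType) (S : algType F) (A B C D : S).
Definition racah_delta := A + B + C.
Definition racah_alpha_elt := commutator A D + A * C - B * A.
Definition racah_beta_elt := commutator B D + B * A - C * B.
Local Notation delta := racah_delta.
Local Notation alpha := racah_alpha_elt.
Local Notation beta := racah_beta_elt.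

Definition racah_monomial (e : exponent) : S :=
  let: (i, j, k, l, m, n) := e in
  A ^+ i * B ^+ j * D ^+ k * (delta ^+ l * alpha ^+ m * beta ^+ n).
Definition weight (e : exponent) : nat :=
  let: (i, j, k, l, m, n) := e in
  (2 * i + 2 * j + 3 * k + 2 * l + 4 * m + 4 * n)%N.
Local Notation mon := racah_monomial.

(** An inductive form of a span. Once left multiplication by each generator preserves the union over
    [d], every word lies in it. *)
Inductive fil d : S -> Prop :=
| fil0 : fil d 0
| filD x y : fil d x -> fil d y -> fil d (x + y)
| fil_mon c e : (weight e <= d)%N -> fil d (c *: mon e).

Hypothesis F2 : 2%N \notin [pchar F].
Hypothesis AB : commutator A B = D *+ 2.
Hypothesis BC : commutator B C = D *+ 2.
Hypothesis CA : commutator C A = D *+ 2.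
Hypothesis alphaC : forall u, alpha * u = u * alpha.
Hypothesis betaC : forall u, beta * u = u * beta.

Lemma filZ d c x : fil d x -> fil d (c *: x).
Proof.
elim=> [|u v _ fu _ fv|a e ed]; first by rewrite scaler0; exact: fil0.
  by rewrite scalerDr; exact: filD.
by rewrite scalerA; exact: fil_mon.
Qed.

Lemma filN d x : fil d x -> fil d (- x).
Proof. by rewrite -scaleN1r; exact: filZ. Qed.

Lemma filB d x y : fil d x -> fil d y -> fil d (x - y).
Proof. by move=> fx fy; apply: filD => //; exact: filN. Qed.

Lemma fil_mono d e x : (d <= e)%N -> fil d x -> fil e x.
Proof.
move=> de; elim=> [|u v _ fu _ fv|a m md]; [exact: fil0|exact: filD|].
by apply: fil_mon; lia.
Qed.

Lemma fil1mon e : fil (weight e) (mon e).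
Proof. by rewrite -[mon e]scale1r; exact: fil_mon. Qed.

Lemma filMl d w u :
  (forall e, (weight e <= d)%N -> fil (weight e + w) (u * mon e)) ->
  forall x, fil d x -> fil (d + w) (u * x).
Proof.
move=> H x; elim=> [|y z _ fy _ fz|c e ed].
- by rewrite mulr0; exact: fil0.
- by rewrite mulrDr; exact: filD.
- rewrite -scalerAr; apply: filZ; apply: fil_mono (H e ed); lia.
Qed.

Lemma monA i j k l m n : mon (i.+1, j, k, l, m, n) = A * mon (i, j, k, l, m, n).
Proof. by rewrite /racah_monomial exprS -!mulrA. Qed.

Lemma monB j k l m n :
  mon (0, j.+1, k, l, m, n)%N = B * mon (0, j, k, l, m, n)%N.
Proof. by rewrite /racah_monomial exprS expr0 !mul1r -!mulrA. Qed.

Lemma monD k l m n : mon (0, 0, k.+1, l, m, n)%N = D * mon (0, 0, k, l, m, n)%N.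
Proof. by rewrite /racah_monomial exprS expr0 !mul1r -!mulrA. Qed.

Lemma filA d x : fil d x -> fil (d + 2) (A * x).
Proof.
apply: filMl => -[[[[[i j] k] l] m] n] _; rewrite -monA.
by apply: fil_mono (fil1mon _); rewrite /=; lia.
Qed.

Lemma fil_alpha d x : fil d x -> fil (d + 4) (alpha * x).
Proof.
apply: filMl => -[[[[[i j] k] l] m] n] _.
suff -> : alpha * mon (i, j, k, l, m, n) = mon (i, j, k, l, m.+1, n).
  by apply: fil_mono (fil1mon _); rewrite /=; lia.
rewrite /racah_monomial alphaC exprSr -!mulrA; do 4!congr (_ * _).
by rewrite alphaC.
Qed.

Lemma fil_beta d x : fil d x -> fil (d + 4) (beta * x).
Proof.
apply: filMl => -[[[[[i j] k] l] m] n] _.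
suff -> : beta * mon (i, j, k, l, m, n) = mon (i, j, k, l, m, n.+1).
  by apply: fil_mono (fil1mon _); rewrite /=; lia.
by rewrite /racah_monomial betaC exprSr -!mulrA.
Qed.

Lemma commutator_delta (u : S) :
  delta * u - u * delta = commutator A u + commutator B u + commutator C u.
Proof.
rewrite /racah_delta /commutator !mulrDl !mulrDr !opprD.
by rewrite addrACA (addrACA (A * u)).
Qed.

(** In [commutator delta A] the contributions of [B] and [C] cancel, and likewise for [B]. As [D] is
    half of [commutator A B], the characteristic enters here. *)
Lemma delta_comm :
  [/\ GRing.comm delta A, GRing.comm delta B & GRing.comm delta D].
Proof.
have commN (u v : S) : commutator u v = - commutator v u by rewrite opprB.
have commuu (u : S) : commutator u u = 0 by rewrite /commutator subrr.
have dA : GRing.comm delta A.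
  apply: subr0_eq; rewrite commutator_delta commuu (commN B A) AB CA.
  by rewrite add0r addNr.
have dB : GRing.comm delta B.
  apply: subr0_eq; rewrite commutator_delta commuu (commN C B) AB BC.
  by rewrite addr0 subrr.
split=> //; have : GRing.comm delta ((2%:R : F)^-1 *: (D *+ 2)).
  rewrite -AB /GRing.comm -scalerAr -scalerAl; congr (_ *: _).
  by apply: commrB; apply: commrM.
have -> : D *+ 2 = (2%:R : F) *: D by rewrite scaler_nat.
by rewrite scalerA mulVf ?scale1r //; exact: F2_neq0.
Qed.

Lemma fil_delta d x : fil d x -> fil (d + 2) (delta * x).
Proof.
have [dA dB dD] := delta_comm.
apply: filMl => -[[[[[i j] k] l] m] n] _.
suff -> : delta * mon (i, j, k, l, m, n) = mon (i, j, k, l.+1, m, n).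
  by apply: fil_mono (fil1mon _); rewrite /=; lia.
rewrite /racah_monomial mulrA.
have -> : delta * (A ^+ i * B ^+ j * D ^+ k) = A ^+ i * B ^+ j * D ^+ k * delta.
  by do 2?[apply: commrM]; apply: commrX.
by rewrite exprS -!mulrA.
Qed.

Lemma mul_BA u : B * (A * u) = A * (B * u) - (D * u) *+ 2.
Proof. by rewrite -mulrnAl -AB mulrBl -!mulrA opprB addrC subrK. Qed.

Lemma mul_C u : C * u = delta * u - A * u - B * u.
Proof.
rewrite -!mulrBl /racah_delta; congr (_ * _).
by rewrite -[RHS]addrA -opprD addrAC subrr add0r.
Qed.

(** The definition of [alpha] solved for [D * A]: the correction terms have weight 4, one less than
    [D * A]. *)
Lemma mul_DA u :
  D * (A * u) = A * (D * u) - (alpha * u + B * (A * u) - A * (C * u)).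
Proof.
rewrite /racah_alpha_elt /commutator !mulrDl !mulNr -!mulrA.
by rewrite subrK addrK opprB addrC subrK.
Qed.

Lemma mul_DB u :
  D * (B * u) = B * (D * u) - (beta * u + C * (B * u) - B * (A * u)).
Proof.
rewrite /racah_beta_elt /commutator !mulrDl !mulNr -!mulrA.
by rewrite subrK addrK opprB addrC subrK.
Qed.

Lemma filMn d x n : fil d x -> fil d (x *+ n).
Proof.
move=> fx; have -> : x *+ n = (n%:R : F) *: x by rewrite scaler_nat.
exact: filZ.
Qed.

(** The cut-off concerns the weight of the product, which makes an induction on [w] possible. *)
Let stepB w := forall d x, (d + 2 <= w)%N -> fil d x -> fil (d + 2) (B * x).
Let stepD w := forall d x, (d + 3 <= w)%N -> fil d x -> fil (d + 3) (D * x).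

Lemma stepC d x : stepB (d + 2) -> fil d x -> fil (d + 2) (C * x).
Proof.
move=> hB fx; rewrite mul_C; apply: filB; last exact: hB.
by apply: filB; [exact: fil_delta | exact: filA].
Qed.

Lemma stepB_leq v w : (v <= w)%N -> stepB w -> stepB v.
Proof. by move=> vw hB d x dv; apply: hB; exact: leq_trans vw. Qed.

(* The two statements are proved together by induction on the weight of the
   product: rewriting [B A] only meets products by [D] of smaller weight,
   whereas rewriting [D B] meets a product by [B] of the same weight. *)
Lemma stepBD w : stepB w /\ stepD w.
Proof.
elim: w => [|w [hB hD]]; first by split=> d x; lia.
have hB' : stepB w.+1.
  move=> d x dw; apply: filMl => -[[[[[i j] k] l] m] n] ed.
  case: i ed => [|i] ed.
    by rewrite -monB; apply: fil_mono (fil1mon _); rewrite /=; lia.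
  rewrite monA mul_BA; have fu := fil1mon (i, j, k, l, m, n).
  set u := mon _ in fu *; set e := weight _ in fu.
  have we : weight (i.+1, j, k, l, m, n) = (e + 2)%N by rewrite /e /=; lia.
  rewrite we in ed *.
  apply: filB; first by apply/filA/hB => //; lia.
  by apply/filMn/(@fil_mono (e + 3)); [lia | apply: hD => //; lia].
split=> // d x dw; apply: filMl => -[[[[[i j] k] l] m] n] ed.
case: i ed => [|i] ed.
  case: j ed => [|j] ed.
    by rewrite -monD; apply: fil_mono (fil1mon _); rewrite /=; lia.
  rewrite monB mul_DB; have fu := fil1mon (0, j, k, l, m, n)%N.
  set u := mon _ in fu *; set e := weight _ in fu.
  have we : weight (0, j.+1, k, l, m, n)%N = (e + 2)%N by rewrite /e /=; lia.
  rewrite we in ed *.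
  have fBu : fil (e + 2) (B * u) by apply: hB => //; lia.
  apply: filB.
    apply: (@fil_mono (e + 3 + 2)); first by lia.
    by apply: hB'; [lia | apply: hD => //; lia].
  apply: filB; last first.
    by apply: (@fil_mono (e + 2 + 2)); [lia | apply: hB; [lia | exact: filA]].
  apply: filD; first by apply: (@fil_mono (e + 4)); [lia | exact: fil_beta].
  apply: (@fil_mono (e + 2 + 2)); first by lia.
  by apply: stepC => //; apply: stepB_leq hB; lia.
rewrite monA mul_DA; have fu := fil1mon (i, j, k, l, m, n).
set u := mon _ in fu *; set e := weight _ in fu.
have we : weight (i.+1, j, k, l, m, n) = (e + 2)%N by rewrite /e /=; lia.
rewrite we in ed *.
apply: filB.
  apply: (@fil_mono (e + 3 + 2)); first by lia.
  by apply: filA; apply: hD => //; lia.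
apply: filB; last first.
  apply: (@fil_mono (e + 2 + 2)); first by lia.
  by apply: filA; apply: stepC => //; apply: stepB_leq hB; lia.
apply: filD; first by apply: (@fil_mono (e + 4)); [lia | exact: fil_alpha].
apply: (@fil_mono (e + 2 + 2)); first by lia.
by apply: hB; [lia | exact: filA].
Qed.

Lemma fil_B d x : fil d x -> fil (d + 2) (B * x).
Proof. by have [hB _] := stepBD (d + 2); exact: hB. Qed.

Lemma fil_D d x : fil d x -> fil (d + 3) (D * x).
Proof. by have [_ hD] := stepBD (d + 3); exact: hD. Qed.

Lemma fil_C d x : fil d x -> fil (d + 2) (C * x).
Proof. by apply: stepC => e y _; exact: fil_B. Qed.
End RacahSpan.

(** * The scalars by which the six Racah elements act on leading data *)

Section ScalarSymbols.
Variables (F : fieldType) (K : fieldType) (iota : {rmorphism F -> K}).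
Variables (xi x y z r s : K) (h : F).
Hypotheses (F2 : 2%N \notin [pchar F]) (xi0 : xi != 0) (h2 : h *+ 2 = 1).
Local Notation "c 't'" := (c *: 'X : {poly K}) (at level 2, format "c  't'").
Local Notation phi := (scalars iota).
Local Notation X := (x_op phi (phi h) x t r t s t).
Local Notation Y := (y_op phi (phi h) x t y t z t r t s t).
Local Notation Z := (z_op phi (phi h) x t y t z t r t s t).
Local Notation sym := (symbol (iota := iota) xi).
Local Notation c16 := ((16%:R : F)^-1).

(** Once [h *+ 2 = 1], each of the three elements acts as multiplication by a polynomial, which
    commutes with every linear operator. *)
Lemma module_central (u : linalg phi) :
  [/\ commutator (anticommutator X Y - Z) u = 0,
      commutator (anticommutator Y Z - X) u = 0
    & commutator (anticommutator Z X - Y) u = 0].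
Proof.
have hh : phi h *+ 2 = 1 by rewrite -rmorphMn h2 rmorph1.
have scalarC (k : {poly K}) (M : linalg phi) :
    (forall f i, M f i = k * f i) -> commutator M u = 0.
  move=> Mk; have {}Mk f : M f = k *: f by apply/funext => i; exact: Mk.
  apply/eqP; rewrite subr_eq0; apply/eqP/linopP => f.
  by rewrite -[LHS]/(M (u f)) -[RHS]/(u (M f)) !Mk linopZ.
have opE (M N P : linalg phi) k :
    (forall f i, M (N f) i + N (M f) i = P f i + k * f i) ->
    commutator (anticommutator M N - P) u = 0.
  move=> MNP; apply: (scalarC k) => f i.
  transitivity (M (N f) i + N (M f) i - P f i); first by [].
  by rewrite MNP addrC addKr.
split; apply: opE => f i.
- by rewrite [LHS]xy_fun hh mul1r.
- by rewrite [LHS]yz_fun hh mul1r.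
- by rewrite [LHS]zx_fun hh mul1r.
Qed.

(** Top coefficients of [down] at even and at odd positions. *)
Let qe := s + x + y - z.
Let qo := r + x + y + z.
Let px := x_sym xi x r s.
Let py := y_sym xi x y z r s.
Let pz := z_sym xi x y z r s.
Let sX : sym 1 X px. Proof. exact: x_symbol. Qed.
Let sY : sym 1 Y py. Proof. exact: y_symbol. Qed.
Let sZ : sym 1 Z pz. Proof. exact: z_symbol. Qed.
(** The scalars of the anticommutators of the symbols: [kappa], [mu] and [lambda] with [h] set to
    0. *)
Let kappa0 := s * qe + r * qo + x * y *+ 2.
Let mu0 := x * z *+ 2 - s * qe + r * qo.
Let lambda0 := y * z *+ 2 - s * qe + r * qo.

Ltac symbol_pair := congr pair;
  rewrite /px /py /pz /x_sym /y_sym /z_sym /dilate /kappa0 /mu0 /lambda0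
    /qe /qo /=; field; by rewrite ?xi0.
Ltac symbol_ring := move=> u; try (move: (iota _) => c0); symbol_pair.

Lemma symbol_A : sym 2 (zeta_image X)
  (dilate (iota c16 * ((x ^+ 2 + r * s * xi) *+ 4))).
Proof. apply: eq_symbol (symbol_square sX). symbol_ring. Qed.

Lemma symbol_B : sym 2 (zeta_image Y)
  (dilate (iota c16 * ((y ^+ 2 + qe * qo / xi) *+ 4))).
Proof. apply: eq_symbol (symbol_square sY). symbol_ring. Qed.

Lemma symbol_delta : sym 2 (zeta_image X + zeta_image Y + zeta_image Z)
  (dilate (iota c16 * ((x ^+ 2 + y ^+ 2 + z ^+ 2 + s * qe + r * qo) *+ 4))).
Proof.
apply: eq_symbol (symbolD (symbolD (symbol_square sX) (symbol_square sY))
  (symbol_square sZ)).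
symbol_ring.
Qed.

Lemma symbol_D :
  sym 3 ((2%:R : F)^-1 *: commutator (zeta_image X) (zeta_image Y))
  (dilate (iota (2%:R^-1 * (c16 ^+ 2 *+ 16)) *
    ((s * qe * (x + y + z) + r * qo * (x + y - z)
      - x * (qe * qo / xi) *+ 2 - y * (r * s * xi) *+ 2) *+ 2))).
Proof.
rewrite (image_D module_central); move: (2%:R^-1 * _ : F) => c.
apply: eq_symbol (symbolZ c (symbol_e sX sY sZ)).
symbol_ring.
Qed.

(** [mu0 ^+ 2 - kappa0 ^+ 2] is a difference of squares, and both factors split again into two
    linear ones. In factored form its degree can be read off later. *)
Lemma symbol_alpha_elt : sym 4
  (racah_alpha_elt (zeta_image X) (zeta_image Y) (zeta_image Z)
     ((2%:R : F)^-1 *: commutator (zeta_image X) (zeta_image Y)))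
  (dilate (iota (c16 * (2%:R^-1 * c16 ^+ 2) *+ 64) *
    (- ((s + x) * (s + y - z) * (r + x) * (r + y + z)) *+ 8))).
Proof.
rewrite /racah_alpha_elt (image_alpha F2 module_central).
move: (_ *+ 64 : F) => c.
apply: eq_symbol
  (symbolZ c (symbol_alpha (ka := kappa0) (mu := mu0) sX sY sZ _ _)).
- symbol_ring.
- symbol_ring.
- symbol_ring.
Qed.

Lemma symbol_beta_elt : sym 4
  (racah_beta_elt (zeta_image X) (zeta_image Y) (zeta_image Z)
     ((2%:R : F)^-1 *: commutator (zeta_image X) (zeta_image Y)))
  (dilate (iota (c16 * (2%:R^-1 * c16 ^+ 2) *+ 64) *
    (((s + y) * (s + x - z) * (r + y) * (r + x + z)) *+ 8))).
Proof.
have central' u : [/\ commutator (anticommutator Y Z - X) u = 0,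
    commutator (anticommutator Z X - Y) u = 0
  & commutator (anticommutator X Y - Z) u = 0].
  by have [] := module_central u.
(* Since [commutator A B = commutator B C], [beta] is [alpha] for the cyclically shifted triple [Y],
   [Z], [X]. *)
rewrite /racah_beta_elt -(zeta_BC module_central).
rewrite (image_alpha F2 central'); move: (_ *+ 64 : F) => c.
apply: eq_symbol
  (symbolZ c (symbol_alpha (ka := lambda0) (mu := kappa0) sY sZ sX _ _)).
- symbol_ring.
- symbol_ring.
- symbol_ring.
Qed.
End ScalarSymbols.

(** * Symbols of ordered monomials and of their linear combinations *)

Definition monomial_value (R : pzRingType) (v : R * R * R * R * R * R)
    (e : exponent) : R :=
  let: (vA, vB, vD, vd, va, vb) := v in let: (i, j, k, l, m, n) := e in
  vA ^+ i * vB ^+ j * vD ^+ k * (vd ^+ l * va ^+ m * vb ^+ n).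

Section MonomialSymbols.
Variables (F : fieldType) (K : fieldType) (iota : {rmorphism F -> K}).
Variable xi : K.
Local Notation S := (linalg (scalars iota)).
Local Notation sym := (symbol (iota := iota) xi).

Lemma symbol_dilateM w v (M N : S) a b :
  sym w M (dilate a) -> sym v N (dilate b) ->
  sym (w + v) (M * N) (dilate (a * b)).
Proof.
move=> sM sN; apply: eq_symbol (symbolM sM sN) => u.
by rewrite /dilate /= !mulrA.
Qed.

Lemma symbol_dilateX w (M : S) a n :
  sym w M (dilate a) -> sym (w * n) (M ^+ n) (dilate (a ^+ n)).
Proof.
move=> sM; elim: n => [|n IHn].
  rewrite muln0; apply: eq_symbol (@symbol1 _ _ _ _) => -[a1 a2].
  by rewrite /dilate !mul1r.
by rewrite !exprS mulnS; exact: symbol_dilateM.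
Qed.

Lemma symbol_dilate_sum (I : eqType) (s : seq I) w (M : I -> S) (a : I -> K) :
  (forall i, i \in s -> sym w (M i) (dilate (a i))) ->
  sym w (\sum_(i <- s) M i) (dilate (\sum_(i <- s) a i)).
Proof.
elim: s => [|i s IHs] sMa.
  rewrite !big_nil; apply: eq_symbol (@symbol0 _ _ _ _ _) => u.
  by rewrite /dilate !mul0r.
rewrite !big_cons; have sMi := sMa _ (mem_head _ _).
apply: eq_symbol (symbolD sMi (IHs _)) => [u|j js].
  by rewrite /dilate !mulrDl.
by apply: sMa; rewrite inE js orbT.
Qed.

Lemma symbol_dilate0 w a : sym w 0 (dilate a) -> a = 0.
Proof.
(* A sequence with nonzero leading data is needed to detect [a]; constants in geometric progression
   suffice. *)
pose f : two_chain {poly K} := fun i => (xi ^ i.2)%:P.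
have lf : lead xi 0 f (1, 1).
  by move=> i; case: i.1; rewrite mul1r; exact: topC.
move=> /(_ _ _ _ lf (false, 0)) /=; rewrite expr0z !mulr1 => s0.
by rewrite (top_uniq s0 (top0 _ _)).
Qed.

(** Brings the terms of a sum to a common weight [v], where those of smaller weight have symbol
    0. *)
Lemma symbol_dilateZ w v (M : S) a c : (w <= v)%N -> sym w M (dilate a) ->
  sym v (c *: M) (dilate (if w == v then iota c * a else 0)).
Proof.
move=> wv sM; have scM := symbolZ c sM.
case: eqP => [<-|/eqP neq].
  by apply: eq_symbol scM => u; rewrite /dilate /= !mulrA.
apply: eq_symbol (symbol_raise _ scM) => [u|]; first by rewrite /dilate !mul0r.
by rewrite ltn_neqAle neq.
Qed.

Lemma symbol_monomial (A B C D : S) vA vB vD vd va vb e :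
  sym 2 A (dilate vA) -> sym 2 B (dilate vB) -> sym 3 D (dilate vD) ->
  sym 2 (racah_delta A B C) (dilate vd) ->
  sym 4 (racah_alpha_elt A B C D) (dilate va) ->
  sym 4 (racah_beta_elt A B C D) (dilate vb) ->
  sym (weight e) (racah_monomial A B C D e)
    (dilate (monomial_value (vA, vB, vD, vd, va, vb) e)).
Proof.
case: e => -[[[[i j] k] l] m] n sA sB sD sd sa sb.
have -> : weight (i, j, k, l, m, n)
  = (2 * i + 2 * j + 3 * k + (2 * l + 4 * m + 4 * n))%N by rewrite /weight; lia.
by do ![apply: symbol_dilateM | exact: symbol_dilateX].
Qed.
End MonomialSymbols.

Lemma rmorph_monomial (F : fieldType) (S T : algType F)
    (f : {lrmorphism S -> T}) (A B C D : S) e :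
  f (racah_monomial A B C D e) = racah_monomial (f A) (f B) (f C) (f D) e.
Proof.
case: e => -[[[[i j] k] l] m] n /=.
rewrite /racah_delta /racah_alpha_elt /racah_beta_elt !(rmorphM, rmorphXn) /=.
by rewrite !(rmorphB, rmorphD, rmorphM).
Qed.

(** * The ordered monomials span the Racah algebra *)

Section RacahElements.
Variable F : fieldType.
Hypothesis F2 : 2%N \notin [pchar F].
Local Notation A := (racah_A F).
Local Notation B := (racah_B F).
Local Notation C := (racah_C F).
Local Notation D := (racah_D F).

Lemma racah_relations : [/\ commutator A B = D *+ 2, commutator B C = D *+ 2,
  commutator C A = D *+ 2,
  forall u, racah_alpha_elt A B C D * u = u * racah_alpha_elt A B C D
  & forall u, racah_beta_elt A B C D * u = u * racah_beta_elt A B C D].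
Proof.
pose p : {lrmorphism _ -> _} := pres_pi (racah_pres F).
have p0 r : racah_relator r -> p r = 0.
  by move=> rr; apply/pres_pi_eq0/ideal_gen_incl.
have pD x y t : p (commutator x y - t *+ 2) = commutator (p x) (p y) - p t *+ 2.
  by rewrite rmorphB rmorphMn rmorph_commutator.
have pC x y t v u : p (commutator (commutator x y + x * t - v * x) u)
    = commutator (commutator (p x) (p y) + p x * p t - p v * p x) (p u).
  by rewrite rmorph_commutator rmorph_racah_relation.
split.
- apply: subr0_eq; rewrite -[LHS](pD (free_gen F _) _ (free_gen F _)).
  exact/p0/racah_AB.
- apply: subr0_eq; rewrite -[LHS](pD (free_gen F _) _ (free_gen F _)).
  exact/p0/racah_BC.
- apply: subr0_eq; rewrite -[LHS](pD (free_gen F _) _ (free_gen F _)).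
  exact/p0/racah_CA.
- move=> u; have [x ->] := pres_pi_surj u; apply: subr0_eq.
  exact: etrans (esym (pC _ _ _ _ x)) (p0 _ (racah_alpha x)).
- move=> u; have [x ->] := pres_pi_surj u; apply: subr0_eq.
  exact: etrans (esym (pC _ _ _ _ x)) (p0 _ (racah_beta x)).
Qed.

Lemma racah_fil (u : racah F) : exists d, fil A B C D d u.
Proof.
have [AB BC CA alC beC] := racah_relations.
have filT d e x : fil A B C D d x -> fil A B C D (maxn d e) x.
  by move=> fx; apply: fil_mono fx; lia.
have [x ->] := pres_pi_surj u.
rewrite [x]monalgE rmorph_sum /=; elim: (enum_fset _) => [|w s [d IHs]].
  by rewrite big_nil; exists 0; exact: fil0.
(* The empty word is the monomial with all exponents 0, and each further letter acts by left
   multiplication. *)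
have [e we] : exists e, fil A B C D e (pres_pi (racah_pres F) << w >>).
  case: w => w; elim: w => [|i w [e we]].
    have -> : << FMonom [::] >> = 1 :> free_alg F 4 by rewrite -fmoneE.
    exists 0%N; rewrite rmorph1; have := fil1mon A B C D (0, 0, 0, 0, 0, 0)%N.
    by rewrite /racah_monomial !expr0 !mulr1.
  have -> : << FMonom (i :: w) >> = free_gen F i * << FMonom w >>
      :> free_alg F 4.
    rewrite malgM_def fgmulUU mulr1; congr << _ >>; apply/eqP.
    by rewrite fmP /= fmM fmU.
  rewrite rmorphM /= -/(pres_gen (racah_pres F) i).
  have -> : i = inord i by rewrite inord_val.
  case: i => -[|[|[|[|i]]]] //= _.
  - by exists (e + 2)%N; exact: filA.
  - by exists (e + 2)%N; exact: fil_B.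
  - by exists (e + 2)%N; exact: fil_C.
  - by exists (e + 3)%N; exact: fil_D.
rewrite big_cons; exists (maxn e d); apply: filD; last first.
  by rewrite maxnC; exact: filT.
apply: filT; have -> : << x@_w *g w >> = x@_w *: << w >> :> free_alg F 4.
  by apply/malgP=> k; rewrite mcoeffZ !mcoeffU mulr_natr.
by rewrite linearZ; exact: filZ.
Qed.

Lemma racah_monomial_sum (u : racah F) :
  exists (s : seq exponent) (c : exponent -> F),
  [/\ uniq s, {in s, forall e, c e != 0}
    & u = \sum_(e <- s) c e *: racah_monomial A B C D e].
Proof.
(* Formal combinations of exponents merge repeated monomials and discard zero coefficients. *)
pose ev := mmap (in_alg (racah F)) (racah_monomial A B C D).
suff [Q ->] : exists Q, u = ev Q.
  exists (msupp Q), (mcoeff^~ Q); split; first exact: fset_uniq.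
    by move=> e; rewrite -mcoeff_neq0.
  by rewrite /ev mmapE; apply: eq_bigr => e _; rewrite /= mulr_algl.
have [d] := racah_fil u; elim=> [|x y _ [Q ->] _ [P ->]|c e _].
- by exists 0; rewrite /ev mmap0.
- by exists (Q + P); rewrite /ev mmapD.
- by exists << c *g e >>; rewrite /ev mmapU /= mulr_algl.
Qed.
End RacahElements.

(** * Independence of the six scalars *)

Lemma seq_argmax (I : eqType) (s : seq I) (g : I -> nat) : s != [::] ->
  exists2 i, i \in s & {in s, forall j, (g j <= g i)%N}.
Proof.
elim: s => // i [|j s] IHs _.
  by exists i => [|k]; rewrite inE // => /eqP ->.
have [k ks km] := IHs isT; have [ki|ik] := leqP (g k) (g i).
  exists i; first exact: mem_head.
  move=> l; rewrite inE => /orP[/eqP -> //|/km lk]; exact: leq_trans lk ki.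
exists k; first by rewrite inE ks orbT.
by move=> l; rewrite inE => /orP[/eqP ->|/km //]; exact: ltnW.
Qed.

Section Independence.
Variable F : fieldType.
Implicit Types p q : {poly F}.

(** The term of largest degree has nothing to cancel against. *)
Lemma distinct_degrees_free (I : eqType) (s : seq I) (g : I -> nat)
    (p : I -> {poly F}) (a : I -> F) :
  uniq s -> {in s &, injective g} -> {in s, forall i, top (g i) (p i) (a i)} ->
  {in s, forall i, a i != 0} -> \sum_(i <- s) p i = 0 -> s = [::].
Proof.
move=> us gI pa a0 sum0.
apply/eqP/negPn/negP => /(@seq_argmax _ _ g)[i si imax].
have /eqP := congr1 (fun q : {poly F} => q`_(g i)) sum0; apply/negP.
rewrite coef0 coef_sum (bigD1_seq i) //= big_seq_cond big1 ?addr0.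
  by have [_ ->] := pa i si; exact: a0.
move=> j /andP[sj ji]; have [pj _] := pa j sj; apply: pj.
by rewrite ltn_neqAle imax // andbT; apply: contra ji => /eqP/gI->.
Qed.

Lemma topXn n : top n ('X^n : {poly F}) 1.
Proof. by split=> [j nj|]; rewrite coefXn ?eqxx // gtn_eqF. Qed.

Lemma top_exp d p a n : top d p a -> top (d * n) (p ^+ n) (a ^+ n).
Proof.
move=> pa; elim: n => [|n IHn]; first by rewrite muln0; exact: topC.
by rewrite mulnS !exprS; exact: topM.
Qed.

Lemma topDl d e p q a b :
  (e < d)%N -> top d p a -> top e q b -> top d (p + q) a.
Proof.
move=> ed pa qb; rewrite -[a]addr0; exact: topD pa (top_raise ed qb).
Qed.

Lemma topBl d e p q a b :
  (e < d)%N -> top d p a -> top e q b -> top d (p - q) a.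
Proof. by move=> ed pa qb; apply: topDl ed pa (topN qb). Qed.

Lemma topDr d e p q a b :
  (e < d)%N -> top e p a -> top d q b -> top d (p + q) b.
Proof. by move=> ed pa qb; rewrite addrC; exact: topDl ed qb pa. Qed.

Lemma topMn d p a n : top d p a -> top d (p *+ n) (a *+ n).
Proof.
move=> pa; elim: n => [|n IHn]; first exact: top0.
by rewrite !mulrS; exact: topD.
Qed.

(* Exponents that grow fast enough to make the top coefficients below those
   for the lexicographic order s > z > x > y > r. *)
Variables a1 a2 a3 a4 a5 : nat.
Hypotheses (h1 : (10 <= a1)%N) (h2 : (10 * a1 <= a2)%N) (h3 : (10 * a2 <= a3)%N)
  (h4 : (10 * a3 <= a4)%N) (h5 : (10 * a4 <= a5)%N).
Let T : {poly F} := 'X.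
Let r1 : {poly F} := 'X^a1.
Let y : {poly F} := 'X^a2.
Let x : {poly F} := 'X^a3.
Let z : {poly F} := 'X^a4.
Let s : {poly F} := 'X^a5.
(** [xi] will be the inverse of [T]. Then [r * xi] is the polynomial [r1] and division by [xi] is
    multiplication by [T], so all six scalars are polynomials. *)
Let r := r1 * T.
Let qe := s + x + y - z.
Let qo := r + x + y + z.

Definition poly_A := x ^+ 2 + r1 * s.
Definition poly_B := y ^+ 2 + qe * qo * T.
Definition poly_delta := x ^+ 2 + y ^+ 2 + z ^+ 2 + s * qe + r * qo.
Definition poly_D := s * qe * (x + y + z) + r * qo * (x + y - z)
  - x * (qe * qo * T) *+ 2 - y * (r1 * s) *+ 2.
Definition poly_alpha := (s + x) * (s + y - z) * (r + x) * (r + y + z).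
Definition poly_beta := (s + y) * (s + x - z) * (r + y) * (r + x + z).

Let tx : top a3 x 1 := topXn a3.
Let ty : top a2 y 1 := topXn a2.
Let tz : top a4 z 1 := topXn a4.
Let ts : top a5 s 1 := topXn a5.
Let tT : top 1 T 1. Proof. by have := topXn 1; rewrite expr1. Qed.
Let tr1 : top a1 r1 1 := topXn a1.
Let tr : top (a1 + 1) r 1.
Proof. by rewrite -[X in top _ _ X]mulr1; exact: topM tr1 tT. Qed.
Let tqe : top a5 qe 1.
Proof.
have t1 : top a5 (s + x) 1 by apply: topDl ts tx; lia.
have t2 : top a5 (s + x + y) 1 by apply: topDl t1 ty; lia.
by apply: topBl t2 tz; lia.
Qed.
Let tqo : top a4 qo 1.
Proof.
have t1 : top a3 (r + x) 1 by apply: topDr tr tx; lia.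
have t2 : top a3 (r + x + y) 1 by apply: topDl t1 ty; lia.
by apply: topDr t2 tz; lia.
Qed.
Let txyz : top a4 (x + y + z) 1.
Proof.
have t1 : top a3 (x + y) 1 by apply: topDl tx ty; lia.
by apply: topDr t1 tz; lia.
Qed.
Let txyz' : top a4 (x + y - z) (- 1).
Proof.
have t1 : top a3 (x + y) 1 by apply: topDl tx ty; lia.
by apply: topDr t1 (topN tz); lia.
Qed.

Lemma top_poly_A : top (a5 + a1) poly_A 1.
Proof.
have := topM tr1 ts; rewrite mulr1 addnC => t.
by apply: topDr (top_exp 2 tx) t; lia.
Qed.

Lemma top_poly_B : top (a5 + a4 + 1) poly_B 1.
Proof.
have := topM (topM tqe tqo) tT; rewrite !mulr1 => t.
by apply: topDr (top_exp 2 ty) t; lia.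
Qed.

Lemma top_poly_delta : top (2 * a5) poly_delta 1.
Proof.
have := topM ts tqe; rewrite mulr1 addnn -mul2n => t.
have tq : top (a4 * 2) (x ^+ 2 + y ^+ 2 + z ^+ 2) (1 ^+ 2).
  have t1 : top (a3 * 2) (x ^+ 2 + y ^+ 2) (1 ^+ 2).
    by apply: topDl (top_exp 2 tx) (top_exp 2 ty); lia.
  by apply: topDr t1 (top_exp 2 tz); lia.
have t2 : top (2 * a5) (x ^+ 2 + y ^+ 2 + z ^+ 2 + s * qe) 1.
  by apply: topDr tq t; lia.
by apply: topDl t2 (topM tr tqo); lia.
Qed.

(** [s * s * z] dominates, since the other three products contain at most one factor of degree
    [a5]. *)
Lemma top_poly_D : top (2 * a5 + a4) poly_D 1.
Proof.
have := topM (topM ts tqe) txyz; rewrite !mulr1 addnn -mul2n => t.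
have t1 : top (2 * a5 + a4) (s * qe * (x + y + z) + r * qo * (x + y - z)) 1.
  by apply: topDl t (topM (topM tr tqo) txyz'); lia.
have t2 := topMn 2 (topM tx (topM (topM tqe tqo) tT)).
have t3 : top (2 * a5 + a4) (s * qe * (x + y + z) + r * qo * (x + y - z)
    - x * (qe * qo * T) *+ 2) 1 by apply: topBl t1 t2; lia.
by apply: topBl t3 (topMn 2 (topM ty (topM tr1 ts))); lia.
Qed.

Lemma top_poly_alpha : top (2 * a5 + a4 + a3) poly_alpha 1.
Proof.
have t1 : top a5 (s + x) 1 by apply: topDl ts tx; lia.
have t2 : top a5 (s + y - z) 1.
  have t : top a5 (s + y) 1 by apply: topDl ts ty; lia.
  by apply: topBl t tz; lia.
have t3 : top a3 (r + x) 1 by apply: topDr tr tx; lia.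
have t4 : top a4 (r + y + z) 1.
  have t : top a2 (r + y) 1 by apply: topDr tr ty; lia.
  by apply: topDr t tz; lia.
have := topM (topM (topM t1 t2) t3) t4; rewrite !mulr1.
by have -> : (a5 + a5 + a3 + a4 = 2 * a5 + a4 + a3)%N by lia.
Qed.

Lemma top_poly_beta : top (2 * a5 + a4 + a2) poly_beta 1.
Proof.
have t1 : top a5 (s + y) 1 by apply: topDl ts ty; lia.
have t2 : top a5 (s + x - z) 1.
  have t : top a5 (s + x) 1 by apply: topDl ts tx; lia.
  by apply: topBl t tz; lia.
have t3 : top a2 (r + y) 1 by apply: topDr tr ty; lia.
have t4 : top a4 (r + x + z) 1.
  have t : top a3 (r + x) 1 by apply: topDr tr tx; lia.
  by apply: topDr t tz; lia.
have := topM (topM (topM t1 t2) t3) t4; rewrite !mulr1.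
by have -> : (a5 + a5 + a2 + a4 = 2 * a5 + a4 + a2)%N by lia.
Qed.

Definition monomial_degree (e : exponent) : nat :=
  let: (i, j, k, l, m, n) := e in
  ((a5 + a1) * i + (a5 + a4 + 1) * j + (2 * a5 + a4) * k + (2 * a5 * l
   + (2 * a5 + a4 + a3) * m + (2 * a5 + a4 + a2) * n))%N.

Definition scaled_values (cA cB cD cd ca cb : F) :=
  (cA *: poly_A, cB *: poly_B, cD *: poly_D, cd *: poly_delta,
   ca *: poly_alpha, cb *: poly_beta).

Lemma topZ d p a c : top d p a -> top d (c *: p) (c * a).
Proof. by rewrite -mul_polyC => pa; exact: topM (topC c) pa. Qed.

Lemma top_monomial_value cA cB cD cd ca cb e :
  top (monomial_degree e) (monomial_value (scaled_values cA cB cD cd ca cb) e)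
    (monomial_value (cA, cB, cD, cd, ca, cb) e).
Proof.
case: e => -[[[[i j] k] l] m] n; rewrite /monomial_degree /monomial_value /=.
rewrite -[cA]mulr1 -[cB]mulr1 -[cD]mulr1 -[cd]mulr1 -[ca]mulr1 -[cb]mulr1.
do ![apply: topM]; apply: top_exp; rewrite ?mulr1 -[X in top _ _ X]mulr1;
  apply: topZ.
- exact: top_poly_A.
- exact: top_poly_B.
- exact: top_poly_D.
- exact: top_poly_delta.
- exact: top_poly_alpha.
- exact: top_poly_beta.
Qed.
End Independence.

Lemma digits_inj N a b a' b' : (a < N)%N -> (a' < N)%N ->
  (a + N * b = a' + N * b')%N -> a = a' /\ b = b'.
Proof.
move=> aN a'N E; have N0 : (0 < N)%N by lia.
split; [move/(congr1 (modn^~ N)): E | move/(congr1 (divn^~ N)): E].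
  by rewrite /= ![(N * _)%N]mulnC ![(_ + _ * N)%N]addnC !modnMDl !modn_small.
rewrite /= ![(N * _)%N]mulnC ![(_ + _ * N)%N]addnC !divnMDl //.
by rewrite !divn_small // !addn0.
Qed.

(* In base [N] the digits of the degree are [j], [i], [n], [m],
   [j + k + m + n] and [i + j + 2 (k + l + m + n)]; all but the last one are
   bounded by the weight. *)
Lemma monomial_degree_inj N d (e e' : exponent) :
  (d < N)%N -> (weight e <= d)%N -> (weight e' <= d)%N ->
  monomial_degree N (N ^ 2) (N ^ 3) (N ^ 4) (N ^ 5) e
  = monomial_degree N (N ^ 2) (N ^ 3) (N ^ 4) (N ^ 5) e' -> e = e'.
Proof.
case: e e' => -[[[[i j] k] l] m] n [[[[[i' j'] k'] l'] m'] n'].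
rewrite /weight /monomial_degree => dN ed ed'.
have E i0 j0 k0 l0 m0 n0 : ((N ^ 5 + N) * i0 + (N ^ 5 + N ^ 4 + 1) * j0
    + (2 * N ^ 5 + N ^ 4) * k0
    + (2 * N ^ 5 * l0 + (2 * N ^ 5 + N ^ 4 + N ^ 3) * m0
    + (2 * N ^ 5 + N ^ 4 + N ^ 2) * n0))%N
  = (j0 + N * (i0 + N * (n0 + N * (m0 + N * (j0 + k0 + m0 + n0
      + N * (i0 + j0 + 2 * k0 + 2 * l0 + 2 * m0 + 2 * n0))))))%N by ring.
rewrite !E.
(* Five rounds split off the lower digits, which give all exponents except [l]; the last quotient
   gives [l]. *)
do 5!(move=> /digits_inj H; have {H}[||?] := H; [lia | lia |]).
move=> E5; congr (_, _, _, _, _, _); lia.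
Qed.

(** * Representations of the Bannai-Ito algebra and the values of the six scalars *)

Lemma bi_hom_exists (F : fieldType) (S : algType F) (X Y Z : S) :
  (forall u, [/\ commutator (anticommutator X Y - Z) u = 0,
      commutator (anticommutator Y Z - X) u = 0
    & commutator (anticommutator Z X - Y) u = 0]) ->
  exists f : {lrmorphism bannai_ito F -> S},
    [/\ f (bi_X F) = X, f (bi_Y F) = Y & f (bi_Z F) = Z].
Proof.
move=> central; pose g (i : 'I_3) := nth 0 [:: X; Y; Z] i.
have gX : g (inord 0) = X by rewrite /g inordK.
have gY : g (inord 1) = Y by rewrite /g inordK.
have gZ : g (inord 2) = Z by rewrite /g inordK.
have [|f fE] := @presented_alg_lift F 3 _ g (bi_pres F).
  pose ev : {rmorphism free_alg F 3 -> S} := free_eval g.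
  have evE x y t u : ev (commutator (anticommutator x y - t) u)
      = commutator (anticommutator (ev x) (ev y) - ev t) (ev u).
    by rewrite rmorph_commutator rmorphB rmorph_anticommutator.
  have [eX eY eZ] : [/\ ev (free_gen F (inord 0)) = X,
      ev (free_gen F (inord 1)) = Y & ev (free_gen F (inord 2)) = Z].
    by split; apply: etrans (free_eval_gen g _) _.
  move=> r; rewrite -[free_eval g r]/(ev r); case=> u; rewrite evE ?eX ?eY ?eZ;
  by have [] := central (ev u).
by exists f; split; rewrite fE.
Qed.

Section ModuleValues.
Variables (F : fieldType) (F2 : 2%N \notin [pchar F]) (a1 a2 a3 a4 a5 : nat).
Variables (K : fieldType) (f : {rmorphism {poly F} -> K}).
Hypothesis T0 : f 'X != 0.
Local Notation iota := (f \o polyC : {rmorphism F -> K}).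
Local Notation c16 := ((16%:R : F)^-1).
Let x : K := f 'X^a3.
Let y : K := f 'X^a2.
Let z : K := f 'X^a4.
Let s : K := f 'X^a5.
Let r : K := f ('X^a1 * 'X).

(** Numerical factors of the six scalars, in the order [A], [B], [D], [delta], [alpha], [beta]. Up
    to sign they are powers of 1/2, hence nonzero. *)
Definition racah_constants : F * F * F * F * F * F :=
  (c16 *+ 4, c16 *+ 4, (2%:R^-1 * (c16 ^+ 2 *+ 16)) *+ 2, c16 *+ 4,
   - ((c16 * (2%:R^-1 * c16 ^+ 2) *+ 64) *+ 8),
   (c16 * (2%:R^-1 * c16 ^+ 2) *+ 64) *+ 8).

Lemma racah_constants_neq0 e : monomial_value racah_constants e != 0.
Proof.
have n2 := F2_neq0 F2.
have n16 : (16%:R : F) != 0 by rewrite (natrX F 2 4) expf_neq0.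
have n4 : (4%:R : F) != 0 by rewrite (natrX F 2 2) expf_neq0.
have n8 : (8%:R : F) != 0 by rewrite (natrX F 2 3) expf_neq0.
have n64 : (64%:R : F) != 0 by rewrite (natrX F 2 6) expf_neq0.
have Mn (c : F) n : n%:R != 0 :> F -> c != 0 -> c *+ n != 0.
  by move=> n0 c0; rewrite -mulr_natr mulf_neq0.
case: e => -[[[[i j] k] l] m] n; rewrite /monomial_value /=.
have c0 : c16 != 0 by rewrite invr_eq0.
have d0 : (2%:R : F)^-1 != 0 by rewrite invr_eq0.
have eA : c16 *+ 4 != 0 by exact: Mn.
have eD : (2%:R^-1 * (c16 ^+ 2 *+ 16)) *+ 2 != 0.
  by apply: (Mn) => //; rewrite mulf_neq0 // Mn // expf_neq0.
have ea : (c16 * (2%:R^-1 * c16 ^+ 2) *+ 64) *+ 8 != 0.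
  by apply: (Mn) => //; apply: Mn => //; rewrite !mulf_neq0 ?expf_neq0.
by rewrite !mulf_neq0 ?expf_neq0 ?oppr_eq0.
Qed.

Lemma morph_scale c p : f (c *: p) = iota c * f p.
Proof. by rewrite -mul_polyC rmorphM. Qed.

Ltac value_ring :=
  rewrite morph_scale ?[iota (- _)]rmorphN [iota (_ *+ _)]rmorphMn;
  move: (iota _) => c; rewrite /x /y /z /s /r;
  rewrite !(rmorphM, rmorphD, rmorphN, rmorphMn, expr2) /=;
  move: (f 'X^a1) (f 'X^a2) (f 'X^a3) (f 'X^a4) (f 'X^a5) (f 'X) T0
    => q1 q2 q3 q4 q5 t t0;
  by field; rewrite ?invr_eq0 ?oner_eq0 ?andbT.

Let qe := s + x + y - z.
Let qo := r + x + y + z.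

(** This and the next five lemmas match the polynomials with the scalars of the symbols at
    [xi = (f 'X)^-1]. *)
Lemma value_A : f ((c16 *+ 4) *: poly_A F a1 a3 a5)
  = iota c16 * ((x ^+ 2 + r * s * (f 'X)^-1) *+ 4).
Proof. rewrite /poly_A. value_ring. Qed.

Lemma value_B : f ((c16 *+ 4) *: poly_B F a1 a2 a3 a4 a5)
  = iota c16 * ((y ^+ 2 + qe * qo / (f 'X)^-1) *+ 4).
Proof. rewrite /poly_B /qe /qo. value_ring. Qed.

Lemma value_delta : f ((c16 *+ 4) *: poly_delta F a1 a2 a3 a4 a5)
  = iota c16 * ((x ^+ 2 + y ^+ 2 + z ^+ 2 + s * qe + r * qo) *+ 4).
Proof. rewrite /poly_delta /qe /qo. value_ring. Qed.

Lemma value_D :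
  f (((2%:R^-1 * (c16 ^+ 2 *+ 16)) *+ 2) *: poly_D F a1 a2 a3 a4 a5)
  = iota (2%:R^-1 * (c16 ^+ 2 *+ 16)) *
    ((s * qe * (x + y + z) + r * qo * (x + y - z)
      - x * (qe * qo / (f 'X)^-1) *+ 2 - y * (r * s * (f 'X)^-1) *+ 2) *+ 2).
Proof. rewrite /poly_D /qe /qo. value_ring. Qed.

Lemma value_alpha :
  f ((- ((c16 * (2%:R^-1 * c16 ^+ 2) *+ 64) *+ 8))
      *: poly_alpha F a1 a2 a3 a4 a5)
  = iota (c16 * (2%:R^-1 * c16 ^+ 2) *+ 64) *
    (- ((s + x) * (s + y - z) * (r + x) * (r + y + z)) *+ 8).
Proof. rewrite /poly_alpha. value_ring. Qed.

Lemma value_beta :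
  f (((c16 * (2%:R^-1 * c16 ^+ 2) *+ 64) *+ 8) *: poly_beta F a1 a2 a3 a4 a5)
  = iota (c16 * (2%:R^-1 * c16 ^+ 2) *+ 64) *
    (((s + y) * (s + x - z) * (r + y) * (r + x + z)) *+ 8).
Proof. rewrite /poly_beta. value_ring. Qed.
End ModuleValues.

Lemma rmorph_zeta_image (F : fieldType) (S T : algType F)
    (f : {lrmorphism S -> T}) u : f (zeta_image u) = zeta_image (f u).
Proof.
have fZ c v : f (c *: v) = c *: f v by exact: linearZ.
rewrite /zeta_image fZ rmorphM rmorphB rmorph_nat rmorphD rmorph1.
by congr (_ *: ((_ - _) * (_ + _))); exact: fZ.
Qed.

(** * Triviality of the kernel of zeta *)

Section Injectivity.
Variables (F : fieldType) (F2 : 2%N \notin [pchar F]).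
Variable zeta : {lrmorphism racah F -> bannai_ito F}.
Hypotheses (zetaA : zeta (racah_A F) = zeta_image (bi_X F))
  (zetaB : zeta (racah_B F) = zeta_image (bi_Y F))
  (zetaC : zeta (racah_C F) = zeta_image (bi_Z F)).
Variables (K : fieldType) (f : {rmorphism {poly F} -> K}).
Hypothesis f_inj : injective f.
Local Notation iota := (f \o polyC : {rmorphism F -> K}).
Local Notation mon :=
  (racah_monomial (racah_A F) (racah_B F) (racah_C F) (racah_D F)).

Lemma zeta_symbols (N : nat) :
  exists g : {lrmorphism bannai_ito F -> linalg (scalars iota)},
  forall e, symbol (iota := iota) (f 'X)^-1 (weight e) (g (zeta (mon e)))
    (dilate (f (monomial_value
      (let: (cA, cB, cD, cd, ca, cb) := racah_constants F in
       scaled_values N (N ^ 2) (N ^ 3) (N ^ 4) (N ^ 5) cA cB cD cd ca cb) e))).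
Proof.
have T0 : f 'X != 0 by rewrite -(rmorph0 f) (inj_eq f_inj) polyX_eq0.
have xi0 : (f 'X)^-1 != 0 by rewrite invr_eq0.
have h2 : (2%:R : F)^-1 *+ 2 = 1.
  by rewrite -(mulr_natr _^-1) mulVf //; exact: F2_neq0.
have [g [gX gY gZ]] := bi_hom_exists (@module_central F K iota
  (f 'X^(N ^ 3)) (f 'X^(N ^ 2)) (f 'X^(N ^ 4)) (f ('X^N * 'X)) (f 'X^(N ^ 5))
  _ h2).
move: gX gY gZ; set X := x_op _ _ _ _ _; set Y := y_op _ _ _ _ _ _ _.
set Z := z_op _ _ _ _ _ _ _ => gX gY gZ; exists g => e.
have gA : g (zeta (racah_A F)) = zeta_image X.
  by rewrite zetaA rmorph_zeta_image gX.
have gB : g (zeta (racah_B F)) = zeta_image Y.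
  by rewrite zetaB rmorph_zeta_image gY.
have gC : g (zeta (racah_C F)) = zeta_image Z.
  by rewrite zetaC rmorph_zeta_image gZ.
(* [zeta] is prescribed on [A], [B], [C] only; its value at [D] follows from the relation between
   [commutator A B] and [D], as 2 is invertible. *)
have gD : g (zeta (racah_D F))
    = (2%:R : F)^-1 *: commutator (zeta_image X) (zeta_image Y).
  have ZE c v : g (zeta (c *: v)) = c *: g (zeta v) by rewrite !linearZ.
  have [AB _ _ _ _] := racah_relations F.
  have CE u v :
      g (zeta (commutator u v)) = commutator (g (zeta u)) (g (zeta v)).
    by rewrite !rmorph_commutator.
  have -> : racah_D F = (2%:R : F)^-1 *: commutator (racah_A F) (racah_B F).
    have -> : commutator (racah_A F) (racah_B F) = (2%:R : F) *: racah_D F.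
      by rewrite scaler_nat.
    by rewrite scalerA mulVf ?scale1r //; exact: F2_neq0.
  by rewrite ZE CE gA gB.
rewrite !rmorph_monomial gD gA gB gC.
apply: eq_symbol (symbol_monomial e (symbol_A iota _ _ _ _ xi0)
  (symbol_B iota _ _ _ _ _ _ xi0) (symbol_D iota _ _ _ _ _ xi0 h2)
  (symbol_delta iota _ _ _ _ _ _ xi0)
  (symbol_alpha_elt iota _ _ _ _ _ F2 xi0 h2)
  (symbol_beta_elt iota _ _ _ _ _ F2 xi0 h2)) => u.
congr (dilate _ u).
rewrite -(value_A N (N ^ 2) (N ^ 3) (N ^ 4) (N ^ 5) T0).
rewrite -(value_B N (N ^ 2) (N ^ 3) (N ^ 4) (N ^ 5) T0).
rewrite -(value_D N (N ^ 2) (N ^ 3) (N ^ 4) (N ^ 5) T0).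
rewrite -(value_delta N (N ^ 2) (N ^ 3) (N ^ 4) (N ^ 5) T0).
rewrite -(value_alpha N (N ^ 2) (N ^ 3) (N ^ 4) (N ^ 5) T0).
rewrite -(value_beta N (N ^ 2) (N ^ 3) (N ^ 4) (N ^ 5) T0).
rewrite /racah_constants /scaled_values.
case: e => -[[[[i j] k] l] m] n; rewrite /monomial_value.
by rewrite !(rmorphM f) !(rmorphXn f).
Qed.

Lemma zeta_kernel u : zeta u = 0 -> u = 0.
Proof.
have [s [c [us c0 ->]]] := racah_monomial_sum F2 u.
have [->|s0] := eqVneq s [::]; first by rewrite big_nil.
have [e0 se0 emax] := seq_argmax weight s0.
(* The module is chosen after [u]. The margin 10 ensures both [d < N], for reading off digits, and
   the growth by factors of 10 required of the powers of [N]. *)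
set d := weight e0 in emax; set N := (d + 10)%N.
have [g gE] := zeta_symbols N; set val := monomial_value _ in gE.
rewrite linear_sum => /(congr1 g); rewrite linear0 linear_sum => sum0.
(* In weight [d] only the terms of maximal weight survive, so the scalars of these alone sum to
   0. *)
have val0 : \sum_(e <- s | weight e == d) c e *: val e = 0.
  apply: f_inj; rewrite rmorph0; apply: (@symbol_dilate0 _ _ iota (f 'X)^-1 d).
  rewrite -sum0 rmorph_sum [X in dilate X]big_mkcond /=.
  apply: symbol_dilate_sum => e se; rewrite !linearZ /=.
  apply: eq_symbol (symbol_dilateZ (c e) (emax e se) (gE e)) => v.
  by rewrite morph_scale.
(* [e0] belongs to this list, so it cannot be empty. *)
suff /eqP : [seq e <- s | weight e == d] = [::].
  rewrite -size_eq0 size_filter -leqn0 leqNgt -has_count.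
  by move=> /hasPn/(_ _ se0); rewrite eqxx.
rewrite -big_filter in val0.
have in_filter e :
    e \in [seq e <- s | weight e == d] -> e \in s /\ weight e = d.
  by rewrite mem_filter => /andP[/eqP].
apply: (distinct_degrees_free
  (g := monomial_degree N (N ^ 2) (N ^ 3) (N ^ 4) (N ^ 5))
  (a := fun e => c e * monomial_value (racah_constants F) e) _ _ _ _ val0).
- exact: filter_uniq.
- move=> e e' /in_filter[_ we] /in_filter[_ we'].
  by apply: (@monomial_degree_inj _ d); rewrite ?we ?we' // /N; lia.
- move=> e _; apply: topZ.
  by apply: top_monomial_value; rewrite ?leq_mul2r ?expnS; nia.
- move=> e /in_filter[se _]; rewrite mulf_neq0 ?c0 //.
  exact: racah_constants_neq0.
Qed.
End Injectivity.

Theorem theorem5p4 (F : fieldType) (F2 : 2%N \notin [pchar F])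
    (zeta : {lrmorphism racah F -> bannai_ito F})
    (zetaA : zeta (racah_A F) = zeta_image (bi_X F))
    (zetaB : zeta (racah_B F) = zeta_image (bi_Y F))
    (zetaC : zeta (racah_C F) = zeta_image (bi_Z F)) :
  injective zeta.
Proof.
(* The field must contain [{poly F}] and an inverse of its variable, hence the fraction field. *)
apply: raddf_inj => u; apply: (@zeta_kernel F F2 zeta zetaA zetaB zetaC
  {fraction {poly F}} (@tofrac {poly F})).
by move=> p q /eqP; rewrite tofrac_eq => /eqP.
Qed.
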